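(* Let $p\in\mathbb{C}[Z]$ be a polynomial of degree $d\ge 3$ with only simple roots. Then there exist vectors $\underline z\in\mathbb{C}^d$ such that $W_p^{\circ n}(\underline z)$ is defined for all $n\ge 0$ and the orbit $(W_p^{\circ n}(\underline z))_{n\ge0}$ tends to infinity (eventually leaves every compact subset of $\mathbb{C}^d$). Moreover, the set of such escaping points contains a holomorphic curve.
   Context: For a monic polynomial $p\in\mathbb{C}[Z]$ of degree $d$, the Weierstrass map $W_p$ is the partially defined map $\mathbb{C}^d\setminus\Delta\to\mathbb{C}^d$, $\underline z\mapsto \underline z'$ with $z'_k=z_k-\dfrac{p(z_k)}{\prod_{j\ne k}(z_k-z_j)}$, where $\Delta=\{\underline z\in\mathbb{C}^d: z_j=z_k\text{ for some }j<k\}$. For non-monic $p$ with leading coefficient $c$, $W_p:=W_{p/c}$. *)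

(* Defs.v *)
From mathcomp Require Import all_boot all_order all_algebra.
From mathcomp Require Import all_classical all_reals all_analysis.
From mathcomp Require Import complex.
Import Order.TTheory GRing.Theory Num.Theory numFieldNormedType.Exports.
Set Implicit Arguments. Unset Strict Implicit. Unset Printing Implicit Defensive.
Local Open Scope ring_scope.
Local Open Scope complex_scope.

Section Weierstrass.
Variable R : realType.
Local Notation C := R[i].

Definition off_diag (d : nat) (z : 'rV[C]_d) : Prop :=
  forall j k : 'I_d, j != k -> z 0 j != z 0 k.

(* The Weierstrass map W_p (for p non-monic: W_{p / lead_coef p}).
   Only meaningful on off-diagonal points (there the formula is W_p). *)
Definition weierstrass (p : {poly C}) (d : nat) (z : 'rV[C]_d) : 'rV[C]_d :=
  \row_k (z 0 k - ((lead_coef p)^-1 * p.[z 0 k])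
                   / \prod_(j < d | j != k) (z 0 k - z 0 j)).

Definition orbit_defined (p : {poly C}) (d : nat) (z : 'rV[C]_d) : Prop :=
  forall n : nat, off_diag (iter n (@weierstrass p d) z).

(* The orbit tends to infinity in C^d (max-norm of iterates -> +oo;
   equivalently it eventually leaves every compact subset of C^d) *)
Definition orbit_to_infty (p : {poly C}) (d : nat) (z : 'rV[C]_d) : Prop :=
  forall M : R, exists N : nat, forall n : nat, (N <= n)%N ->
    exists k : 'I_d, M%:C < `| (iter n (@weierstrass p d) z) 0 k |.

Definition escaping (p : {poly C}) (d : nat) (z : 'rV[C]_d) : Prop :=
  orbit_defined p z /\ orbit_to_infty p z.

Definition C_derivable (f : C -> C) (t : C) : Prop :=
  derivable (f : (C)^o -> (C)^o) t 1.

Definition holomorphic_on_disk (d : nat) (gamma : C -> 'rV[C]_d) (c : C) (r : R)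
  : Prop :=
  forall t : C, `|t - c| < r%:C ->
    forall k : 'I_d, C_derivable (fun s => gamma s 0 k) t.

End Weierstrass.

(* Main.v *)
Require Import Defs.
From mathcomp Require Import all_boot all_order all_algebra.
From mathcomp Require Import all_classical all_reals all_analysis.
From mathcomp Require Import complex separable ring lra.
Import Order.TTheory GRing.Theory Num.Theory numFieldNormedType.Exports.
Local Open Scope ring_scope.
Local Open Scope complex_scope.

(** For a cubic [y^3 + b y + c] the centred plane [x + y + z = 0] is invariant
    and the Weierstrass map descends to the coefficients [(u, v)] of
    [(Z - x)(Z - y)(Z - z) = Z^3 + u Z + v].  In the coordinates
    [u = 1 / (j t^2)], [v = 1 / (j t^3)] the line at infinity is [t = 0], and on
    it the map in [j] has a fixed point [j0] in Q(sqrt 7), which is a saddle: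
    expanding with multiplier [-(6 + sqrt 7)] along the line at infinity, and
    attracting with multiplier [(1 - sqrt 7) / 2] transversally to it.  A
    contraction argument on sequences yields one orbit that converges to the
    line at infinity without leaving a small neighbourhood of the saddle.

    In degree [d > 3] the last [d - 3] components stay at roots of [p], which
    reduces the map to that of the cubic formed by the three other roots.

    The curve is a fibre of the map: the sum of the components is constant
    after one step, so fibres are one-dimensional.  The fibre over an escaping
    point [(z1, z2, z3)] has a branch [(x1, x2, 1 / e)] with [x1 -> z1] and
    [x2 -> z2] as [e -> 0], and on it [x1] and [x2] are given by the quadratic
    formula.  Every point of it lands on the escaping point in one step. *)

Set Implicit Arguments.
Unset Strict Implicit.

(** * The centred cubic in terms of its coefficients *)

(** Since x^3 = - u x - v, the new first component collapses to - (P x + Q) / ((x - y) (x - z)), and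
    likewise for the others. [D] is minus the squared product of the differences, hence the common
    denominator of the symmetric functions, and its nonvanishing separates the components. *)
Lemma weierstrass_centered_cubic (F : fieldType) (b c x y z u v : F) :
  x + y + z = 0 -> u = x * y + y * z + z * x -> v = - (x * y * z) ->
  4 * u ^+ 3 + 27 * v ^+ 2 != 0 ->
  let D := 4 * u ^+ 3 + 27 * v ^+ 2 in
  let P := u + b in let Q := 2 * v + c in
  let x' := x - (x ^+ 3 + b * x + c) / ((x - y) * (x - z)) in
  let y' := y - (y ^+ 3 + b * y + c) / ((y - x) * (y - z)) in
  let z' := z - (z ^+ 3 + b * z + c) / ((z - x) * (z - y)) in
  [/\ [/\ x != y, y != z & z != x], x' + y' + z' = 0,
    x' * y' + y' * z' + z' * x' = (P ^+ 2 * u ^+ 2 + 9 * v * P * Q - 3 * u * Q ^+ 2) / D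
  & - (x' * y' * z') = (Q ^+ 3 + u * Q * P ^+ 2 - v * P ^+ 3) / D].
Proof.
move=> s0 uE vE; have zE : z = - (x + y).
  by apply/eqP; rewrite -subr_eq0 opprK addrC s0.
move=> D0 D P Q x' y' z'.
have DE : D = - ((x - y) * (y - z) * (z - x)) ^+ 2 by rewrite /D uE vE zE; ring.
(* Opaque names for the differences keep [field] from expanding the denominators. *)
have : exists al be ga, [/\ al = x - y, be = y - z & ga = z - x]
  by exists (x - y), (y - z), (z - x).
move=> [al [be [ga [alE beE gaE]]]]; rewrite -alE -beE -gaE in DE.
have [al0 be0 ga0] : [/\ al != 0, be != 0 & ga != 0].
  move: D0; rewrite -/D DE oppr_eq0 expf_eq0 /= !mulf_eq0 !negb_or.
  by case/andP => /andP[].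
have step (w N a b' : F) : a != 0 -> b' != 0 -> w - N / (- (a * b')) = (w * a * b' + N) / (a * b').
  move=> a0 b0; have ab0 : a * b' != 0 by rewrite mulf_neq0.
  by rewrite invrN mulrN opprK mulrDl -(mulrA w) mulfK.
set K := (al * be * ga)^-1.
have xE : x' = (P * x + Q) * be * K.
  rewrite /x' (_ : (x - y) * (x - z) = - (al * ga)); last by rewrite alE gaE; ring.
  rewrite step // (_ : x * _ * _ + _ = P * x + Q); last by rewrite /P /Q alE gaE uE vE zE; ring.
  by rewrite /K; field; rewrite al0 be0 ga0.
have yE : y' = (P * y + Q) * ga * K.
  rewrite /y' (_ : (y - x) * (y - z) = - (al * be)); last by rewrite alE beE; ring.
  rewrite step // (_ : y * _ * _ + _ = P * y + Q); last by rewrite /P /Q alE beE uE vE zE; ring.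
  by rewrite /K; field; rewrite al0 be0 ga0.
have zE' : z' = (P * z + Q) * al * K.
  rewrite /z' (_ : (z - x) * (z - y) = - (be * ga)); last by rewrite beE gaE; ring.
  rewrite step // (_ : z * _ * _ + _ = P * z + Q); last by rewrite /P /Q beE gaE uE vE zE; ring.
  by rewrite /K; field; rewrite al0 be0 ga0.
have KE : D^-1 = - K ^+ 2 by rewrite DE /K invrN exprVn.
have K1 : al * be * ga * K = 1 by rewrite divff // !mulf_neq0.
clearbody K P Q; rewrite {}KE {}xE {}yE {}zE' {x' y' z' step DE D}.
have neq w w' : w - w' != 0 -> w != w' by rewrite subr_eq0.
split; first by split; apply: neq; rewrite -?alE -?beE -?gaE.
- by rewrite alE beE gaE; ring.
- transitivity (K ^+ 2 * (- ((P ^+ 2 * u ^+ 2 + 9 * v * P * Q - 3 * u * Q ^+ 2)))); last by ring.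
  rewrite uE vE alE beE gaE zE; ring.
- transitivity (K ^+ 3 * (al * be * ga) * (- (Q ^+ 3 + u * Q * P ^+ 2 - v * P ^+ 3))).
    by rewrite uE vE zE; ring.
  rewrite (_ : K ^+ 3 * (al * be * ga) = K ^+ 2 * (al * be * ga * K)); last by ring.
  by rewrite K1; ring.
Qed.

(** * Algebra of a fibre *)

Section FibreFormulas.
Variables (F : fieldType) (a2 a1 a0 z1 z2 z3 e : F).
(* Comparing coefficients in [q = g + \sum_k (x_k - z_k) \prod_(j != k) (Z - x_j)],
   where [g = \prod_k (Z - x_k)] and [x_3 = 1 / e], gives two equations
   [e x1 x2 = A1 x1 + A2 x2 + A0] and [L1 x1 + L2 x2 + L0 = 0].  Eliminating
   [x2] and dividing by [e] leaves [L1 x1^2 + B x1 + C = 0]. *)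
Definition fibA1 := e * (z2 + z3) - 1.
Definition fibA2 := e * (z1 + z3) - 1.
Definition fibA0 := z1 + z2 - a1 * e.
Definition fibL1 := (2 - e * z3) * fibA1 - e * z2.
Definition fibL2 := (2 - e * z3) * fibA2 - e * z1.
Definition fibL0 := (2 - e * z3) * fibA0 - e ^+ 2 * a0.
Definition fibB := fibL0 + fibA2 * z2 - fibA1 * z1.
Definition fibC := e * fibA2 * a0 - fibA0 * z1.
Definition fibDisc := fibB ^+ 2 - 4 * fibL1 * fibC.

(** With denominators cleared, the conclusions say that (x1, x2, 1 / e) maps to (z1, z2, z3) under
    the Weierstrass map of [q]. The elimination is run backwards: the quadratic and the linear
    equation return the two original ones, hence the coefficients [a1] and [a0]; [a2] comes from the
    sum of the z's. *)
Lemma fibre_weierstrass (x1 x2 s : F) :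
  (2 : F) != 0 -> e != 0 -> fibL1 != 0 -> fibL2 != 0 -> s ^+ 2 = fibDisc -> z1 + z2 + z3 = - a2 ->
  x1 = (s - fibB) / (2 * fibL1) -> x2 = - (fibL0 + fibL1 * x1) / fibL2 ->
  let q x := x ^+ 3 + a2 * x ^+ 2 + a1 * x + a0 in
  [/\ q x1 = (x1 - z1) * ((x1 - x2) * (x1 - e^-1)),
     q x2 = (x2 - z2) * ((x2 - x1) * (x2 - e^-1))
   & q e^-1 = (e^-1 - z3) * ((e^-1 - x1) * (e^-1 - x2))].
Proof.
move=> n2 en L1n L2n sE sumz x1E x2E q.
have Q1 : fibL1 * x1 ^+ 2 + fibB * x1 + fibC = 0.
  have sx : s = 2 * fibL1 * x1 + fibB by rewrite x1E; field; rewrite ?n2 ?L1n.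
  have : 4 * fibL1 * (fibL1 * x1 ^+ 2 + fibB * x1 + fibC) = 0.
    transitivity (s ^+ 2 - fibDisc); last by rewrite sE subrr.
    by rewrite sx /fibDisc; ring.
  have n4 : (4 : F) != 0 by rewrite (_ : 4 = 2 * 2) ?mulf_neq0 //; ring.
  by move/eqP; rewrite !mulf_eq0 (negPf n4) (negPf L1n) => /eqP.
have E2 : fibL1 * x1 + fibL2 * x2 + fibL0 = 0 by rewrite x2E; field.
have E1 : fibA1 * x1 + fibA2 * x2 + fibA0 - e * x1 * x2 = 0.
  apply: (mulfI L2n); rewrite mulr0.
  transitivity (e * (fibL1 * x1 ^+ 2 + fibB * x1 + fibC)
     + (fibA2 - e * x1) * (fibL1 * x1 + fibL2 * x2 + fibL0)).
    by rewrite /fibB /fibC /fibL0 /fibL1 /fibL2 /fibA0 /fibA1 /fibA2; ring.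
  by rewrite Q1 E2 !mulr0 addr0.
have E3 : 2 * (x1 * x2) - z1 * x2 - z2 * x1 - e * (z3 * x1 * x2) = a0 * e.
  apply: (mulfI en); apply/eqP; rewrite -subr_eq0; apply/eqP.
  transitivity (fibL1 * x1 + fibL2 * x2 + fibL0
    - (2 - e * z3) * (fibA1 * x1 + fibA2 * x2 + fibA0 - e * x1 * x2)).
    by rewrite /fibL0 /fibL1 /fibL2; ring.
  by rewrite E1 E2 mulr0 subr0.
have eV : e * e^-1 = 1 by rewrite divff.
(* [E4] compares the coefficients of Z, and [E5] the constant terms. *)
have E4 : - (x1 * x2 + e^-1 * (x1 + x2)) + (z1 + z2 + z3) * (x1 + x2 + e^-1)
    - z1 * x1 - z2 * x2 - z3 * e^-1 = a1.
  apply/eqP; rewrite -subr_eq0; apply/eqP.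
  transitivity (e^-1 * (fibA1 * x1 + fibA2 * x2 + fibA0 - e * x1 * x2)); last by rewrite E1 mulr0.
  by rewrite /fibA0 /fibA1 /fibA2; field.
have E5 : 2 * (x1 * x2 * e^-1) - z1 * (x2 * e^-1) - z2 * (x1 * e^-1) - z3 * (x1 * x2) = a0.
  by apply: (mulfI en); rewrite mulrC [RHS]mulrC -E3; field.
have a2E : a2 = - (z1 + z2 + z3) by rewrite sumz opprK.
by rewrite /q a2E -E4 -E5; split; ring.
Qed.
End FibreFormulas.

Section EscapingOrbits.
Variable R : realType.
Local Notation C := R[i].
Local Notation n := (@Normc.normc R).
Local Notation sqrtc := (@complex.sqrtc R).

(** * Strict differentiability in two complex variables *)

Lemma normc_ltC (x : C) (r : R) : (`|x| < r%:C) = (n x < r).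
Proof. by case: x => a b; rewrite ltcR. Qed.

Lemma normc_ge0 (x : C) : 0 <= n x.
Proof. by case: x => a b; rewrite sqrtr_ge0. Qed.

Lemma normc_gt0 (x : C) : (0 < n x) = (x != 0).
Proof.
rewrite lt_def normc_ge0 andbT; apply/negb_inj; rewrite !negbK.
by apply/eqP/eqP => [/Normc.eq0_normc //| ->]; rewrite Normc.normc0.
Qed.

Lemma normcB (x y : C) : n (x - y) = n (y - x).
Proof. by rewrite -opprB normcN. Qed.

Lemma le_normcB (x y : C) : n (x - y) <= n x + n y.
Proof. by rewrite (le_trans (le_normcD _ _)) ?normcN. Qed.

Lemma le_normc_dist (z x y : C) : n (x - y) <= n (x - z) + n (z - y).
Proof. by rewrite (_ : x - y = (x - z) + (z - y)) ?le_normcD //; ring. Qed.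

Lemma le_normc_add (x y : C) : n x <= n y + n (x - y).
Proof. by rewrite {1}(_ : x = y + (x - y)) ?le_normcD //; ring. Qed.

Lemma normcR (x : R) : n x%:C = `|x|.
Proof. by rewrite /= expr0n addr0 sqrtr_sqr. Qed.

Lemma normcM_le (x y : C) (a b : R) : n x <= a -> n y <= b -> n (x * y) <= a * b.
Proof. by move=> xa yb; rewrite Normc.normcM ler_pM ?normc_ge0. Qed.

Definition dist2 (p q : C * C) : R := n (p.1 - q.1) + n (p.2 - q.2).

(** Here [a] and [b] are the complex partial derivatives. Comparing two moving points, instead of
    one point with [p0], supplies the Lipschitz constants that the contraction argument needs. *)
Definition strict_diff (f : C * C -> C) (p0 : C * C) (a b : C) : Prop :=
  forall e : R, 0 < e -> exists2 dl : R, 0 < dl & forall p q,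
    dist2 p p0 < dl -> dist2 q p0 < dl ->
    n (f p - f q - (a * (p.1 - q.1) + b * (p.2 - q.2))) <= e * dist2 p q.

Definition strict_diff1 (g : C -> C) (x0 a : C) : Prop :=
  forall e : R, 0 < e -> exists2 dl : R, 0 < dl & forall x y,
    n (x - x0) < dl -> n (y - x0) < dl ->
    n (g x - g y - a * (x - y)) <= e * n (x - y).

Lemma dist2_ge0 p q : 0 <= dist2 p q.
Proof. by rewrite addr_ge0 ?normc_ge0. Qed.

Lemma strict_diff_lip f p0 a b : strict_diff f p0 a b ->
  exists2 dl : R, 0 < dl & exists2 K : R, 0 < K & forall p q,
    dist2 p p0 < dl -> dist2 q p0 < dl -> n (f p - f q) <= K * dist2 p q.
Proof.
move=> /(_ 1 ltr01)[dl dl0 h]; exists dl => //.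
have a0 := normc_ge0 a; have b0 := normc_ge0 b.
exists (1 + n a + n b) => [|p q pd qd]; first by lra.
have := h p q pd qd; have := le_normc_add (f p - f q) (a * (p.1 - q.1) + b * (p.2 - q.2)).
have := le_normcD (a * (p.1 - q.1)) (b * (p.2 - q.2)); rewrite !Normc.normcM /dist2.
have := normc_ge0 (p.1 - q.1); have := normc_ge0 (p.2 - q.2); nra.
Qed.

Lemma strict_diff_cont f p0 a b : strict_diff f p0 a b ->
  forall e : R, 0 < e -> exists2 dl : R, 0 < dl & forall p,
    dist2 p p0 < dl -> n (f p - f p0) < e.
Proof.
move=> /strict_diff_lip[dl dl0 [K K0 h]] e e0.
exists (Num.min dl (e / K)); first by rewrite lt_min dl0 divr_gt0.
move=> p; rewrite lt_min => /andP[pd pe].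
have p00 : dist2 p0 p0 < dl by rewrite /dist2 !subrr Normc.normc0 addr0.
apply: le_lt_trans (h p p0 pd p00) _.
by rewrite mulrC -ltr_pdivlMr.
Qed.

Lemma strict_diff_eq f g p0 a b a' b' : strict_diff f p0 a b ->
  (forall p, f p = g p) -> a = a' -> b = b' -> strict_diff g p0 a' b'.
Proof.
move=> hf fg <- <- e e0; have [dl dl0 h] := hf e e0.
by exists dl => // p q pd qd; rewrite -!fg; apply: h.
Qed.

Lemma strict_diff_cst c p0 : strict_diff (fun _ => c) p0 0 0.
Proof.
move=> e e0; exists 1 => // p q _ _.
by rewrite subrr !mul0r addr0 subrr Normc.normc0 mulr_ge0 ?dist2_ge0 ?ltW.
Qed.

Lemma strict_diff_fst p0 : strict_diff fst p0 1 0.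
Proof.
move=> e e0; exists 1 => // p q _ _.
by rewrite mul1r mul0r addr0 subrr Normc.normc0 mulr_ge0 ?dist2_ge0 ?ltW.
Qed.

Lemma strict_diff_snd p0 : strict_diff snd p0 0 1.
Proof.
move=> e e0; exists 1 => // p q _ _.
by rewrite mul1r mul0r add0r subrr Normc.normc0 mulr_ge0 ?dist2_ge0 ?ltW.
Qed.

Lemma strict_diffD f g p0 a b a' b' :
  strict_diff f p0 a b -> strict_diff g p0 a' b' ->
  strict_diff (fun p => f p + g p) p0 (a + a') (b + b').
Proof.
move=> hf hg e e0; have e2 : 0 < e / 2 by lra.
have [d1 d10 h1] := hf _ e2; have [d2 d20 h2] := hg _ e2.
exists (Num.min d1 d2); first by rewrite lt_min d10.
move=> p q; rewrite !lt_min => /andP[p1 p2] /andP[q1 q2].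
have := h1 p q p1 q1; have := h2 p q p2 q2.
set A := (X in n X <= _) => hA; set B := (X in n X <= _) => hB.
rewrite (_ : _ - _ = A + B); last by rewrite /A /B; ring.
have := le_normcD A B; lra.
Qed.

Lemma strict_diffM f g p0 a b a' b' :
  strict_diff f p0 a b -> strict_diff g p0 a' b' ->
  strict_diff (fun p => f p * g p) p0
    (a * g p0 + f p0 * a') (b * g p0 + f p0 * b').
Proof.
move=> hf hg e e0.
have [d3 d30 [Kf Kf0 lf]] := strict_diff_lip hf.
have [d4 d40 [Kg Kg0 lg]] := strict_diff_lip hg.
have f0 := normc_ge0 (f p0); have g0 := normc_ge0 (g p0).
have [M M0 [fM gM KfM KgM]] : exists2 M : R, 0 < M &
    [/\ n (f p0) <= M, n (g p0) <= M, Kf <= M & Kg <= M].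
  by exists (1 + n (f p0) + n (g p0) + Kf + Kg); [lra | split; lra].
have eM : 0 < e / (4 * M) by rewrite divr_gt0 // mulr_gt0.
have [d1 d10 h1] := hf _ eM; have [d2 d20 h2] := hg _ eM.
have [d5 d50 h5] := strict_diff_cont hf eM.
have [d6 d60 h6] := strict_diff_cont hg eM.
exists (Num.min (Num.min (Num.min d1 d2) (Num.min d3 d4)) (Num.min d5 d6)).
  by rewrite !lt_min d10 d20 d30 d40 d50.
move=> p q; rewrite !lt_min => /andP[/andP[/andP[p1 p2] /andP[p3 p4]] /andP[p5 p6]].
move=> /andP[/andP[/andP[q1 q2] /andP[q3 q4]] /andP[q5 q6]].
have := h1 p q p1 q1; have := h2 p q p2 q2.
set A := (X in n X <= _) => hA; set B := (X in n X <= _) => hB.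
(* Two linearisation errors weighted by values at [p0], and two products of a small factor with a
   Lipschitz one; each gets a quarter of [e]. *)
rewrite (_ : _ - _ = f p0 * A + B * g p0 + (f p - f p0) * (g p - g q)
   + (f p - f q) * (g q - g p0)); last by rewrite /A /B; ring.
set D := dist2 p q in hA hB *; have D0 : 0 <= D by exact: dist2_ge0.
have lfpq : n (f p - f q) <= M * D.
  by apply: le_trans (lf _ _ p3 q3) _; rewrite ler_wpM2r.
have lgpq : n (g p - g q) <= M * D.
  by apply: le_trans (lg _ _ p4 q4) _; rewrite ler_wpM2r.
have t1 : n (f p0 * A) <= e / 4 * D.
  by apply: le_trans (normcM_le fM hA) _; rewrite (_ : M * (_ * D) = e / 4 * D) //; field; lra.
have t2 : n (B * g p0) <= e / 4 * D.
  by apply: le_trans (normcM_le hB gM) _; rewrite (_ : _ * D * M = e / 4 * D) //; field; lra.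
have t3 : n ((f p - f p0) * (g p - g q)) <= e / 4 * D.
  apply: le_trans (normcM_le (ltW (h5 p p5)) lgpq) _.
  by rewrite (_ : _ * (M * D) = e / 4 * D) //; field; lra.
have t4 : n ((f p - f q) * (g q - g p0)) <= e / 4 * D.
  apply: le_trans (normcM_le lfpq (ltW (h6 q q6))) _.
  by rewrite (_ : M * D * _ = e / 4 * D) //; field; lra.
have := le_normcD (f p0 * A + B * g p0 + (f p - f p0) * (g p - g q)) ((f p - f q) * (g q - g p0)).
have := le_normcD (f p0 * A + B * g p0) ((f p - f p0) * (g p - g q)).
have := le_normcD (f p0 * A) (B * g p0); lra.
Qed.

Lemma strict_diff_comp g f p0 c a b :
  strict_diff1 g (f p0) c -> strict_diff f p0 a b ->
  strict_diff (fun p => g (f p)) p0 (c * a) (c * b).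
Proof.
move=> hg hf e e0.
have [d1 d10 [K K0 lf]] := strict_diff_lip hf.
have c0 := normc_ge0 c.
have [|d2 d20 h2] := hg (e / (2 * K)); first by rewrite divr_gt0 // mulr_gt0.
have [d3 d30 h3] := strict_diff_cont hf d20.
have [|d4 d40 h4] := hf (e / (2 * (1 + n c))); first by rewrite divr_gt0 //; lra.
exists (Num.min (Num.min d1 d3) d4); first by rewrite !lt_min d10 d30.
move=> p q; rewrite !lt_min => /andP[/andP[p1 p3] p4] /andP[/andP[q1 q3] q4].
have := h2 _ _ (h3 _ p3) (h3 _ q3); have := h4 _ _ p4 q4.
set A := (X in n X <= _) => hA; set B := (X in n X <= _) => hB.
rewrite (_ : _ - _ = B + c * A); last by rewrite /A /B; ring.
apply: le_trans (le_normcD _ _) _; rewrite Normc.normcM.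
have D0 := dist2_ge0 p q.
have t1 : n B <= e / 2 * dist2 p q.
  apply: (le_trans hB); apply: (le_trans (ler_wpM2l _ (lf _ _ p1 q1))).
    by rewrite ltW // divr_gt0 // mulr_gt0.
  by rewrite (_ : _ * (K * _) = e / 2 * dist2 p q) //; field; lra.
have t2 : n c * n A <= e / 2 * dist2 p q.
  apply: (@le_trans _ _ ((1 + n c) * (e / (2 * (1 + n c)) * dist2 p q))).
    by apply: ler_pM; rewrite ?normc_ge0 //; lra.
  by rewrite (_ : _ * (_ * _) = e / 2 * dist2 p q) //; field; lra.
by lra.
Qed.

(* Both the inverse and the square root satisfy the hypothesis
   with an explicit [k]. *)
Lemma strict_diff1_factor g x0 (k : C -> C -> C) :
  (exists2 d0 : R, 0 < d0 & forall x y, n (x - x0) < d0 -> n (y - x0) < d0 ->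
     g x - g y = k x y * (x - y)) ->
  (forall e : R, 0 < e -> exists2 dl : R, 0 < dl & forall x y,
     n (x - x0) < dl -> n (y - x0) < dl -> n (k x y - k x0 x0) <= e) ->
  strict_diff1 g x0 (k x0 x0).
Proof.
move=> [d0 d00 h0] h e e0; have [d1 d10 h1] := h e e0.
exists (Num.min d0 d1); first by rewrite lt_min d00.
move=> x y; rewrite !lt_min => /andP[x1 x2] /andP[y1 y2].
rewrite h0 // -mulrBl Normc.normcM ler_wpM2r ?normc_ge0 //; exact: h1.
Qed.

Lemma strict_diff1V x0 : x0 != 0 -> strict_diff1 (fun x => x^-1) x0 (- x0 ^- 2).
Proof.
move=> x00; have N0 : 0 < n x0 by rewrite normc_gt0.
have far x : n (x - x0) < n x0 / 2 -> n x0 / 2 < n x.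
  by move=> h; have := le_normc_add x0 x; rewrite normcB; lra.
have far0 x : n (x - x0) < n x0 / 2 -> x != 0.
  by move=> /far h; rewrite -normc_gt0; lra.
rewrite (_ : - x0 ^- 2 = - (x0 * x0)^-1); last by rewrite expr2.
apply: (strict_diff1_factor (k := fun x y => - (x * y)^-1)).
  exists (n x0 / 2) => [|x y /far0 hx /far0 hy]; first by lra.
  by field; rewrite hx hy.
(* With N = [n x0], the difference of the two slopes has numerator at most 5/2 N [d1] and
   denominator at least N^4 / 4, whence [d1]. *)
move=> e e0; set d1 := e * (n x0)^+4 / (10 * n x0).
have d10 : 0 < d1 by rewrite /d1 divr_gt0 ?mulr_gt0 ?exprn_gt0 //; lra.
exists (Num.min (n x0 / 2) d1); first by rewrite lt_min d10 andbT; lra.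
move=> x y; rewrite !lt_min => /andP[x1 x2] /andP[y1 y2].
have hx := far0 _ x1; have hy := far0 _ y1; have hx' := far _ x1; have hy' := far _ y1.
rewrite (_ : _ - _ = (x * (y - x0) + x0 * (x - x0)) / (x * y * (x0 * x0))); last first.
  by field; rewrite hx hy x00.
have lx : n x <= 3 / 2 * n x0 by have := le_normc_add x x0; lra.
rewrite Normc.normcM Normc.normcV !Normc.normcM.
rewrite ler_pdivrMr ?mulr_gt0 //; try lra.
apply: le_trans (le_normcD _ _) _; rewrite !Normc.normcM.
apply: (@le_trans _ _ (5 / 2 * n x0 * d1)).
  have := normc_ge0 (y - x0); have := normc_ge0 (x - x0); nra.
rewrite (_ : 5 / 2 * n x0 * d1 = e * ((n x0 / 2 * (n x0 / 2)) * (n x0 * n x0))); last first.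
  by rewrite /d1; field; lra.
apply: ler_wpM2l; first exact: ltW.
apply: ler_wpM2r; first by rewrite mulr_ge0 // normc_ge0.
by apply: ler_pM; lra.
Qed.

Lemma sqrtc_Re_gt0 (x : C) : 0 < complex.Re x -> 0 < complex.Re (sqrtc x).
Proof.
case: x => a b /= a0.
rewrite sqrtr_gt0 divr_gt0 // ltr_wpDl ?sqrtr_ge0 //.
Qed.

Lemma Re_le_normc (x : C) : complex.Re x <= n x.
Proof.
apply: le_trans (ler_norm _) _.
by rewrite -lecR; apply: le_trans (normc_ge_Re _) _; case: x.
Qed.

(** The slope between x and y is 1 / (sqrt x + sqrt y). Over the right half-plane the principal root
    has positive real part, so this sum stays away from 0. *)
Lemma strict_diff1_sqrtc x0 : 0 < complex.Re x0 ->
  strict_diff1 sqrtc x0 (sqrtc x0 + sqrtc x0)^-1.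
Proof.
move=> r0; set s0 := sqrtc x0; set w := complex.Re s0.
have w0 : 0 < w by exact: sqrtc_Re_gt0.
have near x : n (x - x0) < complex.Re x0 -> 0 < complex.Re (sqrtc x).
  move=> h; apply: sqrtc_Re_gt0.
  have := Re_le_normc (x0 - x); rewrite normcB raddfB /=; lra.
have sumw x y : 0 < complex.Re (sqrtc x) -> 0 < complex.Re (sqrtc y) ->
    complex.Re (sqrtc x) < n (sqrtc x + sqrtc y).
  by move=> hx hy; apply: lt_le_trans (Re_le_normc _); rewrite raddfD /=; lra.
have diff x y : sqrtc x + sqrtc y != 0 ->
    sqrtc x - sqrtc y = (sqrtc x + sqrtc y)^-1 * (x - y).
  move=> h; rewrite (_ : x - y = sqrtc x ^+ 2 - sqrtc y ^+ 2).
    by field.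
  by rewrite !sqr_sqrtc.
have nz x y : 0 < complex.Re (sqrtc x) -> 0 < complex.Re (sqrtc y) ->
    sqrtc x + sqrtc y != 0.
  by move=> hx hy; rewrite -normc_gt0; have := sumw x y hx hy; lra.
have cont x : n (x - x0) < complex.Re x0 -> n (sqrtc x - s0) <= w^-1 * n (x - x0).
  move=> h; have hx := near x h; rewrite diff ?nz //.
  rewrite Normc.normcM Normc.normcV ler_wpM2r ?normc_ge0 //.
  by rewrite lef_pV2 ?posrE // ?normc_gt0 ?nz // addrC ltW // sumw.
apply: (strict_diff1_factor (k := fun x y => (sqrtc x + sqrtc y)^-1)).
  by exists (complex.Re x0) => // x y hx hy; apply: diff; apply: nz; apply: near.
(* The bound w^2 / 4 keeps both roots within w / 4 of [s0], so that their sum has modulus at least w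
   / 2; the other bound makes the numerator at most e w^2 / 2. *)
move=> e e0; set d1 := Num.min (e * w ^+ 3 / 4) (w ^+ 2 / 4).
have d10 : 0 < d1 by rewrite lt_min !divr_gt0 // ?mulr_gt0 ?exprn_gt0.
have [d1e d1w] : d1 <= e * w ^+ 3 / 4 /\ d1 <= w ^+ 2 / 4.
  by rewrite !ge_min !lexx orbT.
clearbody d1.
exists (Num.min (complex.Re x0) d1); first by rewrite lt_min r0.
move=> x y; rewrite !lt_min => /andP[x1 x2] /andP[y1 y2].
have hx := near _ x1; have hy := near _ y1.
have nxy := nz _ _ hx hy; have n00 := nz _ _ w0 w0.
have wd z : n (z - x0) < d1 -> w^-1 * n (z - x0) <= Num.min (w / 4) (e * w ^+ 2 / 4).
  move=> h; rewrite le_min !ler_pdivrMl // ; apply/andP; split.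
    by apply: ltW; apply: lt_le_trans h _; rewrite (_ : w * (w / 4) = w ^+ 2 / 4) //; ring.
  by apply: ltW; apply: lt_le_trans h _; rewrite (_ : w * (e * w ^+ 2 / 4) = e * w ^+ 3 / 4) //; ring.
have := le_trans (cont _ x1) (wd _ x2); have := le_trans (cont _ y1) (wd _ y2).
rewrite !le_min => /andP[cy cy'] /andP[cx cx'].
rewrite -/s0 (_ : (sqrtc x + sqrtc y)^-1 - (s0 + s0)^-1 = - ((sqrtc x - s0) + (sqrtc y - s0))
   / ((s0 + s0) * (sqrtc x + sqrtc y))); last by field; rewrite nxy n00.
rewrite Normc.normcM Normc.normcV normcN Normc.normcM.
have g0 : w <= n (s0 + s0) by exact: ltW (sumw _ _ w0 w0).
have cxy := le_normcD (sqrtc x - s0) (sqrtc y - s0).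
have g1 : w / 2 <= n (sqrtc x + sqrtc y).
  have := le_normc_add (s0 + s0) (sqrtc x + sqrtc y); rewrite normcB.
  rewrite (_ : sqrtc x + sqrtc y - (s0 + s0) = sqrtc x - s0 + (sqrtc y - s0)); last by ring.
  by lra.
rewrite ler_pdivrMr; last by rewrite mulr_gt0 //; lra.
have gg : w * (w / 2) <= n (s0 + s0) * n (sqrtc x + sqrtc y) by apply: ler_pM; lra.
apply: le_trans (_ : e * (w * (w / 2)) <= _); last by rewrite ler_wpM2l // ltW.
by lra.
Qed.

(** * Orbits staying near a saddle *)

Lemma geometric_cvg_real (a : nat -> R) (k M : R) :
  0 <= k < 1 -> (forall m, `|a m.+1 - a m| <= M * k ^+ m) ->
  exists l, forall m, `|l - a m| <= M * k ^+ m / (1 - k).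
Proof.
move=> /andP[k0 k1] h.
have M0 : 0 <= M by have := h 0%N; rewrite expr0 mulr1; apply: le_trans.
have tail m p : `|a (m + p)%N - a m| <= M * k ^+ m / (1 - k).
  (* The factor 1 - k^p strengthens the bound so that the induction closes. *)
  have : `|a (m + p)%N - a m| <= M * k ^+ m * (1 - k ^+ p) / (1 - k).
    elim: p => [|p IH].
      by rewrite addn0 subrr normr0 expr0 subrr mulr0 mul0r.
    rewrite addnS (_ : _ - _ = (a (m + p).+1 - a (m + p)%N) + (a (m + p)%N - a m)); last by ring.
    apply: le_trans (ler_normD _ _) _.
    apply: le_trans (lerD (h _) IH) _.
    rewrite exprD le_eqVlt; apply/orP; left; apply/eqP; rewrite exprS; field; lra.
  move=> hh; apply: le_trans hh _.
  rewrite ler_pM2r ?invr_gt0; last by lra.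
  by rewrite ler_piMr ?mulr_ge0 ?exprn_ge0 //; have := exprn_ge0 p k0; lra.
have cv : cvgn (series (fun m => a m.+1 - a m)).
  apply: normed_cvg.
  apply: (@series_le_cvg _ (fun m => `|a m.+1 - a m|) (geometric M k)) => //.
  - by move=> m; rewrite /geometric /= mulr_ge0 // exprn_ge0.
  - by apply: is_cvg_geometric_series; rewrite ger0_norm.
have sE m : series (fun m => a m.+1 - a m) m = a m - a 0%N.
  by rewrite /series /= telescope_sumr.
exists (limn (series (fun m => a m.+1 - a m)) + a 0%N) => m.
apply/ler_addgt0Pl => e e0.
have /cvgrPdist_lt/(_ e e0) [N _ hN] := cv.
have := hN (N + m)%N (leq_addr _ _); rewrite /= sE => hl.
have := tail m N; rewrite addnC.
set A := (X in `|X| <= _ -> _) => hA; set B := (X in `|X| < _) in hl.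
rewrite (_ : _ - _ = B + A); last by rewrite /A /B; ring.
apply: le_trans (ler_normD _ _) _; apply: lerD => //; exact: ltW.
Qed.

(** Real and imaginary parts converge separately, and their two error bounds add up to the factor
    2. *)
Lemma geometric_cvg (a : nat -> C) (k M : R) :
  0 <= k < 1 -> (forall m, n (a m.+1 - a m) <= M * k ^+ m) ->
  exists l, forall m, n (l - a m) <= 2 * (M * k ^+ m / (1 - k)).
Proof.
move=> k01 h.
have Rle (x : C) : `|complex.Re x| <= n x.
  by rewrite -lecR; apply: le_trans (normc_ge_Re _) _; case: x.
have Ile (x : C) : `|complex.Im x| <= n x.
  case: x => x y /=; rewrite -sqrtr_sqr ler_sqrt ?addr_ge0 ?sqr_ge0 //.
  by rewrite lerDr sqr_ge0.
have [l1 h1] := geometric_cvg_real (a := fun m => complex.Re (a m)) k01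
  (fun m => le_trans (eq_ind _ (fun x => `|x| <= _) (Rle _) _ (raddfB _ _ _)) (h m)).
have [l2 h2] := geometric_cvg_real (a := fun m => complex.Im (a m)) k01
  (fun m => le_trans (eq_ind _ (fun x => `|x| <= _) (Ile _) _ (raddfB _ _ _)) (h m)).
exists (l1 +i* l2) => m; have := h1 m; have := h2 m.
case: (a m) => x y hy hx; rewrite /= in hy hx.
have -> : (l1 +i* l2) - (x +i* y) = (l1 - x)%:C + 'i%C * (l2 - y)%:C by simpc.
apply: le_trans (le_normcD _ _) _; rewrite Normc.normcM !normcR.
have -> : n 'i%C = 1 by rewrite /= expr0n expr1n add0r sqrtr1.
by rewrite mul1r; lra.
Qed.

(** Banach's fixed point theorem for the sup distance, written with pointwise bounds: the Picard
    iterates converge coordinatewise at a rate common to all indices. *)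
Lemma sup_contraction (I : Type) (T : (I -> C) -> I -> C) (c : I -> C) (k r : R) :
  0 <= k < 1 -> 0 <= r ->
  (forall x, (forall i, n (x i - c i) <= r) -> forall i, n (T x i - c i) <= r) ->
  (forall x y M, (forall i, n (x i - c i) <= r) -> (forall i, n (y i - c i) <= r) ->
     (forall i, n (x i - y i) <= M) -> forall i, n (T x i - T y i) <= k * M) ->
  exists2 x, (forall i, n (x i - c i) <= r) & forall i, T x i = x i.
Proof.
move=> k01 r0 inv lip; have /andP[k0 k1] := k01.
pose a m := iter m T c.
have ain m i : n (a m i - c i) <= r.
  elim: m i => [|m IH] i; first by rewrite subrr Normc.normc0.
  exact: inv.
have step m i : n (a m.+1 i - a m i) <= r * k ^+ m.
  elim: m i => [|m IH] i.
    by rewrite expr0 mulr1; exact: (ain 1%N).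
  by rewrite exprS mulrCA; exact: (lip _ _ _ (ain m.+1) (ain m) IH).
have /choice[x hx] : forall i, exists l, forall m,
    n (l - a m i) <= 2 * (r * k ^+ m / (1 - k)).
  by move=> i; exact: (geometric_cvg (a := fun m => a m i) k01 (fun m => step m i)).
(* Used twice: to keep the limit in the closed ball and to obtain the fixed point equation. *)
have small (B : R) : (forall m, B <= 4 * r / (1 - k) * k ^+ m) -> B <= 0.
  move=> hB; apply/ler_addgt0Pr => e e0; rewrite add0r.
  have : ((fun m => 4 * r / (1 - k) * k ^+ m) @ \oo --> (4 * r / (1 - k) * 0 : R))%classic.
    by apply: cvgM; [exact: cvg_cst | apply: cvg_expr; rewrite ger0_norm].
  rewrite mulr0 => /cvgrPdist_lt/(_ e e0)[N _ /(_ N (leqnn _))].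
  rewrite /= sub0r normrN => /ltr_normlW h.
  by apply: ltW; apply: le_lt_trans (hB N) _.
have kr m : 0 <= r * k ^+ m / (1 - k).
  by rewrite divr_ge0 ?mulr_ge0 ?exprn_ge0 //; lra.
have xin i : n (x i - c i) <= r.
  suff : n (x i - c i) - r <= 0 by lra.
  apply: small => m.
  have := le_normc_dist (a m i) (x i) (c i); have := hx i m; have := ain m i; have := kr m.
  rewrite (_ : 4 * r / (1 - k) * k ^+ m = 4 * (r * k ^+ m / (1 - k))); last by ring.
  lra.
exists x => // i; apply/eqP; rewrite -subr_eq0; apply/eqP/Normc.eq0_normc.
apply/eqP; rewrite eq_le normc_ge0 andbT; apply: small => m.
have h1 := lip x (a m) _ xin (ain m) (fun i => hx i m) i.
have := le_normc_dist (a m.+1 i) (T x i) (x i).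
have := hx i m.+1; rewrite (normcB (x i)).
rewrite (_ : 4 * r / (1 - k) * k ^+ m = 4 * (r * k ^+ m / (1 - k))); last by ring.
rewrite exprS (_ : r * (k * k ^+ m) / (1 - k) = k * (r * k ^+ m / (1 - k))); last by ring.
have : k * (r * k ^+ m / (1 - k)) <= r * k ^+ m / (1 - k).
  by rewrite ler_piMl //; lra.
move: h1 => /=; rewrite (_ : k * (2 * _) = 2 * (k * (r * k ^+ m / (1 - k)))); last by ring.
lra.
Qed.

(** Perron's method: the whole orbit is found at once as a fixed point on bounded sequences, without
    building a stable manifold. The last clause excludes the constant orbit at [p0]. *)
Lemma saddle_orbit (H G : C * C -> C) (p0 : C * C) (mu nu : C) (r : R) :
  strict_diff H p0 mu 0 -> strict_diff G p0 0 nu ->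
  H p0 = p0.1 -> G p0 = p0.2 -> 1 < n mu -> n nu < 1 -> 0 < r ->
  exists P : nat -> C * C, [/\ forall m, dist2 (P m) p0 < r,
    forall m, P m.+1 = (H (P m), G (P m)) & (P 0%N).2 != p0.2].
Proof.
move=> dH dG H0 G0 mu1 nu1 r0; have nu0 := normc_ge0 nu.
have mu0 : mu != 0 by rewrite -normc_gt0; lra.
have [e e0 [emu enu]] : exists2 e : R, 0 < e & 1 + 2 * e < n mu /\ n nu + 2 * e < 1.
  exists (Num.min ((n mu - 1) / 4) ((1 - n nu) / 4)).
    by rewrite lt_min; apply/andP; split; lra.
  set e := Num.min _ _.
  have [] : e <= (n mu - 1) / 4 /\ e <= (1 - n nu) / 4.
    by rewrite !ge_min !lexx orbT.
  by lra.
(* The two lower bounds are the Lipschitz constants of the backward and the forward coordinate; 2 e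
   appears because [dist2] adds two coordinate distances. *)
have [k k01 [kmu knu]] : exists2 k : R, 0 <= k < 1 &
    (1 + 2 * e) / n mu <= k /\ n nu + 2 * e <= k.
  exists (Num.max ((1 + 2 * e) / n mu) (n nu + 2 * e)).
    rewrite le_max gt_max ltr_pdivrMr ?mul1r; last by lra.
    by rewrite emu enu andbT orbC (_ : 0 <= _ + _) //; lra.
  by rewrite !le_max !lexx orbT.
have [d1 d10 h1] := dH _ e0; have [d2 d20 h2] := dG _ e0.
pose rho := Num.min r (Num.min d1 d2) / 4.
have [rho0 rhor rho1 rho2] : [/\ 0 < rho, 2 * rho < r, 2 * rho < d1 & 2 * rho < d2].
  have m0 : 0 < Num.min r (Num.min d1 d2) by rewrite !lt_min r0 d10.
  have [m1 m2 m3] : [/\ Num.min r (Num.min d1 d2) <= r,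
      Num.min r (Num.min d1 d2) <= d1 & Num.min r (Num.min d1 d2) <= d2].
    by rewrite !ge_min !lexx !orbT.
  by rewrite /rho; split; lra.
clearbody rho.
(* A sequence of pairs is a family over [nat * bool]: [false] marks the expanding coordinate, [true]
   the contracting one. *)
pose pt (x : nat * bool -> C) m := (x (m, false), x (m, true)).
pose c (i : nat * bool) := if i.2 then p0.2 else p0.1.
(* The expanding coordinate is solved for backwards from its next value, the
   contracting one forwards from its prescribed initial value. *)
pose T (x : nat * bool -> C) (i : nat * bool) : C :=
  let: (m, b) := i in
  if b then (if m is m'.+1 then G (pt x m') else p0.2 + rho%:C)
  else x (m, false) + (x (m.+1, false) - H (pt x m)) / mu.
have near x : (forall i, n (x i - c i) <= rho) -> forall m, dist2 (pt x m) p0 <= 2 * rho.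
  by move=> h m; have := h (m, false); have := h (m, true); rewrite /dist2 /c /=; lra.
have lip x y M : (forall i, n (x i - c i) <= rho) -> (forall i, n (y i - c i) <= rho) ->
    (forall i, n (x i - y i) <= M) -> forall i, n (T x i - T y i) <= k * M.
  move=> hx hy hM.
  have M0 : 0 <= M by apply: le_trans (hM (0%N, true)); exact: normc_ge0.
  have dM m : dist2 (pt x m) (pt y m) <= 2 * M.
    by have := hM (m, false); have := hM (m, true); rewrite /dist2 /=; lra.
  have edM m : e * dist2 (pt x m) (pt y m) <= e * (2 * M).
    by apply: ler_wpM2l (dM m); exact: ltW.
  have px m := near x hx m; have py m := near y hy m.
  case=> [m []] /=.
    case: m => [|m].
      by rewrite subrr Normc.normc0 mulr_ge0 //; case/andP: k01.
    have := h2 (pt x m) (pt y m) (le_lt_trans (px m) rho2) (le_lt_trans (py m) rho2).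
    set A := (X in n X <= _) => hA.
    have hA' := le_trans hA (edM m).
    rewrite (_ : G _ - G _ = A + nu * (x (m, true) - y (m, true))); last first.
      by rewrite /A /=; ring.
    apply: le_trans (le_normcD _ _) _.
    have := normcM_le (lexx (n nu)) (hM (m, true)).
    have : (n nu + 2 * e) * M <= k * M by rewrite ler_wpM2r.
    by lra.
  have := h1 (pt x m) (pt y m) (le_lt_trans (px m) rho1) (le_lt_trans (py m) rho1).
  set A := (X in n X <= _) => hA.
  have hA' := le_trans hA (edM m).
  rewrite (_ : _ - _ = ((x (m.+1, false) - y (m.+1, false)) - A) / mu); last first.
    by rewrite /A /=; field.
  rewrite Normc.normcM Normc.normcV.
  have := le_normcB (x (m.+1, false) - y (m.+1, false)) A; have := hM (m.+1, false).
  move=> hxy hB.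
  have : (1 + 2 * e) / n mu * M <= k * M by rewrite ler_wpM2r.
  apply: le_trans; rewrite mulrAC ler_wpM2r ?invr_ge0 ?normc_ge0 //; lra.
(* The constant sequence at [p0] is fixed by [T] except at the prescribed entry, which moves by
   exactly [rho]; so [T] preserves the ball of radius [rho]. *)
have Tc i : n (T c i - c i) <= rho /\ (i != (0%N, true) -> T c i = c i).
  have ptc m : pt c m = p0 by rewrite /pt /c /=; case: (p0).
  case: i => [m []] /=.
    case: m => [|m]; last by rewrite ptc G0 /c /= subrr Normc.normc0 ltW.
    rewrite /c /= (_ : p0.2 + _ - _ = rho%:C); last by ring.
    by rewrite normcR ger0_norm ?lexx ?ltW.
  by rewrite ptc H0 /c /= subrr mul0r addr0 subrr Normc.normc0 ltW.
have [k0 k1] := andP k01.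
have inv x : (forall i, n (x i - c i) <= rho) -> forall i, n (T x i - c i) <= rho.
  move=> hx i.
  have [-> |i0] := eqVneq i (0%N, true); first by have [] := Tc (0%N, true).
  rewrite -((Tc i).2 i0).
  apply: le_trans (lip x c rho hx _ hx i) _.
    by move=> i'; rewrite subrr Normc.normc0 ltW.
  by rewrite ler_piMl ?ltW.
have [x hx fx] := sup_contraction (T := T) (c := c) k01 (ltW rho0) inv lip.
exists (pt x); split.
- by move=> m; apply: le_lt_trans (near x hx m) rhor.
- move=> m; rewrite {1}/pt; congr (_, _); last by rewrite -fx.
  have /eqP := fx (m, false); rewrite /= -subr_eq0 addrAC subrr add0r.
  by rewrite mulf_eq0 invr_eq0 (negPf mu0) orbF subr_eq0 => /eqP.
- rewrite /= -fx /= addrC -subr_eq0 addrK.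
  by rewrite -normc_gt0 normcR normr_gt0 gt_eqF.
Qed.

(** * The cubic map near infinity *)

(* [P = scaledP * u] and [Q = scaledQ * v] for the [P], [Q] of
   [weierstrass_centered_cubic] at [u = 1 / (j t^2)], [v = 1 / (j t^3)];
   the argument [p] is the pair [(j, t)]. *)
Definition scaledP (b : C) (p : C * C) := 1 + b * p.1 * p.2 ^+ 2.
Definition scaledQ (c : C) (p : C * C) := 2 + c * p.1 * p.2 ^+ 3.
(** As v^2 = j u^3, the numerators of the new u and v in [weierstrass_centered_cubic] are u^4
    [scaledU] and u^3 v [scaledV]. *)
Definition scaledU (b c : C) (p : C * C) :=
  scaledP b p ^+ 2 + 9 * p.1 * scaledP b p * scaledQ c p - 3 * p.1 * scaledQ c p ^+ 2.
Definition scaledV (b c : C) (p : C * C) :=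
  p.1 * scaledQ c p ^+ 3 + scaledQ c p * scaledP b p ^+ 2 - scaledP b p ^+ 3.

Definition sqrt7 : C := (Num.sqrt 7%:R)%:C.
(* A root of [216 j^2 + 52 j + 3], which divides
   [(1 + 8 j)^2 (4 + 27 j) - (1 + 6 j)^3]: on [t = 0] the shape map is
   [j (1 + 8 j)^2 (4 + 27 j) / (1 + 6 j)^3]. *)
Definition j0 : C := - (13 + sqrt7) / 108.

Lemma sqrt7_sq : sqrt7 ^+ 2 = 7.
Proof. by rewrite /sqrt7 -rmorphXn /= sqr_sqrtr ?ler0n // rmorph_nat. Qed.

Lemma natC_neq0 (m : nat) : (m.+1%:R : C) != 0.
Proof. by rewrite pnatr_eq0. Qed.

(** The variable t enters only to order two or higher, so [b] and [c] do not affect the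
    linearisation at the saddle. *)
Lemma strict_diff_scaledP b : strict_diff (scaledP b) (j0, 0) 0 0.
Proof.
have d1 := strict_diff_fst (j0, 0); have d2 := strict_diff_snd (j0, 0).
have dM := strict_diffM (strict_diffM
   (strict_diff_cst b _) d1) (strict_diffM d2 d2).
apply: (strict_diff_eq (strict_diffD (strict_diff_cst 1 _) dM)) => [p||] /=.
- by rewrite /scaledP; ring.
- by ring.
- by ring.
Qed.

Lemma strict_diff_scaledQ c : strict_diff (scaledQ c) (j0, 0) 0 0.
Proof.
have d1 := strict_diff_fst (j0, 0); have d2 := strict_diff_snd (j0, 0).
have dM := strict_diffM (strict_diffM
   (strict_diff_cst c _) d1) (strict_diffM d2 (strict_diffM d2 d2)).
apply: (strict_diff_eq (strict_diffD (strict_diff_cst 2 _) dM)) => [p||] /=.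
- by rewrite /scaledQ; ring.
- by ring.
- by ring.
Qed.

Lemma scaledP0 b : scaledP b (j0, 0) = 1. Proof. by rewrite /scaledP /=; ring. Qed.
Lemma scaledQ0 c : scaledQ c (j0, 0) = 2. Proof. by rewrite /scaledQ /=; ring. Qed.

Lemma scaledU0 b c : scaledU b c (j0, 0) = (5 - sqrt7) / 18.
Proof.
rewrite /scaledU scaledP0 scaledQ0 /= /j0.
by field; rewrite ?natC_neq0.
Qed.

Lemma scaledV0 b c : scaledV b c (j0, 0) = (1 - 2 * sqrt7) / 27.
Proof.
rewrite /scaledV scaledP0 scaledQ0 /= /j0.
by field; rewrite ?natC_neq0.
Qed.

Lemma strict_diff_scaledU b c : strict_diff (scaledU b c) (j0, 0) 6 0.
Proof.
have dP := strict_diff_scaledP b; have dQ := strict_diff_scaledQ c.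
have d1 := strict_diff_fst (j0, 0).
have dPP := strict_diffM dP dP.
have dQQ := strict_diffM dQ dQ.
have dPQ := strict_diffM dP dQ.
have t1 := strict_diffM (strict_diffM (strict_diff_cst 9 _) d1) dPQ.
have t2 := strict_diffM (strict_diffM (strict_diff_cst (- 3) _) d1) dQQ.
apply: (strict_diff_eq (strict_diffD (strict_diffD dPP t1) t2)) => [p||] /=.
- by rewrite /scaledU; ring.
- by rewrite scaledP0 scaledQ0; ring.
- by rewrite scaledP0 scaledQ0; ring.
Qed.

Lemma strict_diff_scaledV b c : strict_diff (scaledV b c) (j0, 0) 8 0.
Proof.
have dP := strict_diff_scaledP b; have dQ := strict_diff_scaledQ c.
have d1 := strict_diff_fst (j0, 0).
have dPP := strict_diffM dP dP.
have dQQ := strict_diffM dQ dQ.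
have t1 := strict_diffM d1 (strict_diffM dQ dQQ).
have t2 := strict_diffM dQ dPP.
have t3 := strict_diffM (strict_diff_cst (- 1) _) (strict_diffM dP dPP).
apply: (strict_diff_eq (strict_diffD (strict_diffD t1 t2) t3)) => [p||] /=.
- by rewrite /scaledV; ring.
- by rewrite scaledP0 scaledQ0; ring.
- by rewrite scaledP0 scaledQ0; ring.
Qed.

(** * The saddle on the line at infinity *)

(** Since D = u^3 (4 + 27 j), one step multiplies u and v by [scaledU] and [scaledV] over 4 + 27 j.
    These two maps give the resulting j = v^2 / u^3 and t = u / v. *)
Definition shapeMap b c (p : C * C) :=
  p.1 * (4 + 27 * p.1) * scaledV b c p ^+ 2 / scaledU b c p ^+ 3.
Definition scaleMap b c (p : C * C) := p.2 * scaledU b c p / scaledV b c p.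

(** Conjugation in Q(sqrt 7), with norms 18 and -27, turns inverses into polynomials in [sqrt7], so
    that later identities reduce modulo [sqrt7_sq]. *)
Lemma scaledU0_conj b c : scaledU b c (j0, 0) * (5 + sqrt7) = 1.
Proof. by rewrite scaledU0; field: sqrt7_sq; rewrite ?natC_neq0. Qed.

Lemma scaledV0_conj b c : scaledV b c (j0, 0) * - (1 + 2 * sqrt7) = 1.
Proof. by rewrite scaledV0; field: sqrt7_sq; rewrite ?natC_neq0. Qed.

Lemma scaledU0_neq0 b c : scaledU b c (j0, 0) != 0.
Proof. by apply/eqP => h; have /eqP := scaledU0_conj b c; rewrite h mul0r eq_sym oner_eq0. Qed.

Lemma scaledV0_neq0 b c : scaledV b c (j0, 0) != 0.
Proof. by apply/eqP => h; have /eqP := scaledV0_conj b c; rewrite h mul0r eq_sym oner_eq0. Qed.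

Lemma invr_scaledU0 b c : (scaledU b c (j0, 0))^-1 = 5 + sqrt7.
Proof. by apply: (mulfI (scaledU0_neq0 b c)); rewrite divff ?scaledU0_neq0 // scaledU0_conj. Qed.

Lemma invr_scaledV0 b c : (scaledV b c (j0, 0))^-1 = - (1 + 2 * sqrt7).
Proof. by apply: (mulfI (scaledV0_neq0 b c)); rewrite divff ?scaledV0_neq0 // scaledV0_conj. Qed.

Lemma shapeMap0 b c : shapeMap b c (j0, 0) = j0.
Proof.
rewrite /shapeMap -exprVn invr_scaledU0 scaledV0 /= /j0.
by field: sqrt7_sq; rewrite ?natC_neq0.
Qed.

Lemma strict_diff_shapeMap b c :
  strict_diff (shapeMap b c) (j0, 0) (- (6 + sqrt7)) 0.
Proof.
have dU := strict_diff_comp (strict_diff1V (scaledU0_neq0 b c)) (strict_diff_scaledU b c).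
have dV := strict_diff_scaledV b c; have d1 := strict_diff_fst (j0, 0).
have dj := strict_diffM d1 (strict_diffD (strict_diff_cst 4 _) (strict_diffM (strict_diff_cst 27 _) d1)).
have dall := strict_diffM (strict_diffM dj (strict_diffM dV dV)) (strict_diffM dU (strict_diffM dU dU)).
apply: (strict_diff_eq dall) => [p||] /=.
- by rewrite /shapeMap -exprVn; ring.
- rewrite -exprVn invr_scaledU0 scaledV0 /j0.
  by field: sqrt7_sq; rewrite ?natC_neq0.
- by ring.
Qed.

Lemma scaleMap0 b c j : scaleMap b c (j, 0) = 0.
Proof. by rewrite /scaleMap /= !mul0r. Qed.

(** The map is t times a quotient, so on t = 0 only the t-derivative survives; it is the value of
    [scaledU / scaledV]. *)
Lemma strict_diff_scaleMap b c :
  strict_diff (scaleMap b c) (j0, 0) 0 ((1 - sqrt7) / 2).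
Proof.
have dV := strict_diff_comp (strict_diff1V (scaledV0_neq0 b c)) (strict_diff_scaledV b c).
have dall := strict_diffM (strict_diffM (strict_diff_snd (j0, 0)) (strict_diff_scaledU b c)) dV.
apply: (strict_diff_eq dall) => [p||] /=.
- by [].
- by ring.
- rewrite invr_scaledV0 scaledU0.
  by field: sqrt7_sq; rewrite ?natC_neq0 ?scaledV0_neq0.
Qed.

Lemma sqrt7_bounds : 2 < Num.sqrt (7 : R) < 3.
Proof.
have h : Num.sqrt (7 : R) ^+ 2 = 7 by rewrite sqr_sqrtr.
by have := sqrtr_ge0 (7 : R); move: h; set s := Num.sqrt _; nra.
Qed.

Lemma normc_shape_multiplier : 1 < n (- (6 + sqrt7)).
Proof.
rewrite (_ : - (6 + sqrt7) = (- (6 + Num.sqrt 7%:R))%:C); last first.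
  by rewrite rmorphN rmorphD /= rmorph_nat.
have := sqrt7_bounds; rewrite normcR normrN => /andP[? ?].
by rewrite ger0_norm; lra.
Qed.

Lemma normc_scale_multiplier : n ((1 - sqrt7) / 2) < 1.
Proof.
rewrite (_ : (1 - sqrt7) / 2 = ((1 - Num.sqrt 7%:R) / 2)%:C); last first.
  by rewrite rmorphM rmorphB fmorphV rmorph1 /= rmorph_nat.
have := sqrt7_bounds; rewrite normcR => /andP[? ?].
by rewrite ltr_norml; lra.
Qed.

Lemma strict_diff_neq0 f p0 (a b : C) : strict_diff f p0 a b -> f p0 != 0 ->
  exists2 dl : R, 0 < dl & forall p, dist2 p p0 < dl -> f p != 0.
Proof.
move=> hf f0; have f0' : 0 < n (f p0) by rewrite normc_gt0.
have [dl dl0 h] := strict_diff_cont hf f0'.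
exists dl => // p /h; rewrite -normc_gt0 => hp.
by have := le_normc_add (f p0) (f p); rewrite normcB; lra.
Qed.

(** * Orbits of cubics that tend to infinity *)

(** Passing back to (u, v) needs t nonzero. Both sides of the equations equal u [scaledU] / (4 + 27
    j) and v [scaledV] / (4 + 27 j) respectively. *)
Lemma cubic_coef_step (b c j t : C) : j != 0 -> t != 0 -> 4 + 27 * j != 0 ->
  scaledU b c (j, t) != 0 -> scaledV b c (j, t) != 0 ->
  let u := (j * t ^+ 2)^-1 in let v := (j * t ^+ 3)^-1 in
  let D := 4 * u ^+ 3 + 27 * v ^+ 2 in
  let P := u + b in let Q := 2 * v + c in
  let j' := shapeMap b c (j, t) in let t' := scaleMap b c (j, t) in
  [/\ D != 0,
     (j' * t' ^+ 2)^-1 = (P ^+ 2 * u ^+ 2 + 9 * v * P * Q - 3 * u * Q ^+ 2) / D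
   & (j' * t' ^+ 3)^-1 = (Q ^+ 3 + u * Q * P ^+ 2 - v * P ^+ 3) / D].
Proof.
move=> jn tn Dn Un Vn u v D P Q j' t'.
have DE : D = (4 + 27 * j) / (j ^+ 3 * t ^+ 6).
  by rewrite /D /u /v; field; rewrite jn tn.
have PE : P = scaledP b (j, t) * u.
  by rewrite /P /u /scaledP /=; field; rewrite jn tn.
have QE : Q = scaledQ c (j, t) * v.
  by rewrite /Q /v /scaledQ /=; field; rewrite jn tn.
have UE : scaledU b c (j, t) = scaledP b (j, t) ^+ 2 + 9 * j * scaledP b (j, t) * scaledQ c (j, t)
   - 3 * j * scaledQ c (j, t) ^+ 2 by [].
have VE : scaledV b c (j, t) = j * scaledQ c (j, t) ^+ 3 + scaledQ c (j, t) * scaledP b (j, t) ^+ 2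
   - scaledP b (j, t) ^+ 3 by [].
split.
- by rewrite DE mulf_neq0 // invr_neq0 // mulf_neq0 // expf_neq0.
- transitivity (scaledU b c (j, t) * (u / (4 + 27 * j))).
    rewrite /j' /t' /shapeMap /scaleMap /u /=.
    by field; rewrite jn tn Dn Un Vn.
  rewrite DE PE QE UE /u /v.
  by field; rewrite jn tn Dn.
- transitivity (scaledV b c (j, t) * (v / (4 + 27 * j))).
    rewrite /j' /t' /shapeMap /scaleMap /v /=.
    by field; rewrite jn tn Dn Un Vn.
  rewrite DE PE QE VE /u /v.
  by field; rewrite jn tn Dn.
Qed.

Lemma j0_neq0 : j0 != 0 /\ n j0 < 1 / 2.
Proof.
have -> : j0 = (- (13 + Num.sqrt 7%:R) / 108)%:C.
  by rewrite /j0 /sqrt7 rmorphM rmorphN rmorphD fmorphV !rmorph_nat.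
have /andP[h1 h2] := sqrt7_bounds; split.
  by rewrite -normc_gt0 normcR normr_gt0; lra.
by rewrite normcR ltr_norml; lra.
Qed.

(** As u / v = t, the decay of t along the saddle orbit is the growth of v relative to u. The bound
    valid at every time will later keep the roots away from a given finite set. *)
Lemma coef_orbit (b c : C) (M : R) : 0 < M -> exists u v : nat -> C,
  [/\ forall m, let D := 4 * u m ^+ 3 + 27 * v m ^+ 2 in
        let P := u m + b in let Q := 2 * v m + c in
        [/\ D != 0,
         u m.+1 = (P ^+ 2 * u m ^+ 2 + 9 * v m * P * Q - 3 * u m * Q ^+ 2) / D
       & v m.+1 = (Q ^+ 3 + u m * Q * P ^+ 2 - v m * P ^+ 3) / D],
     forall m, 1 <= n (u m) /\ M * n (u m) < n (v m)
   & forall K, exists N, forall m, (N <= m)%N -> K * n (u m) < n (v m)].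
Proof.
move=> M0; have [jn jh] := j0_neq0.
have [d1 d10 h1] := strict_diff_neq0 (strict_diff_fst (j0, 0)) jn.
have [d2 d20 h2] := strict_diff_neq0 (strict_diff_scaledU b c) (scaledU0_neq0 b c).
have [d3 d30 h3] := strict_diff_neq0 (strict_diff_scaledV b c) (scaledV0_neq0 b c).
have [d4 d40 h4] : exists2 dl : R, 0 < dl & forall p, dist2 p (j0, 0) < dl -> 4 + 27 * p.1 != 0.
  apply: (strict_diff_neq0 (strict_diffD (strict_diff_cst 4 _)
     (strict_diffM (strict_diff_cst 27 _) (strict_diff_fst (j0, 0))))) => /=.
  (* The value 4 + 27 [j0] is (3 - sqrt 7) / 4. *)
  apply/eqP => h; have : (4 + 27 * j0) * (2 * (3 + sqrt7)) = 1.
    by rewrite /j0; field: sqrt7_sq; rewrite ?natC_neq0.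
  by rewrite h mul0r => /eqP; rewrite eq_sym oner_eq0.
have [nu [dG nu1]] : exists nu, strict_diff (scaleMap b c) (j0, 0) 0 nu /\ n nu < 1.
  by exists ((1 - sqrt7) / 2); split; [exact: strict_diff_scaleMap | exact: normc_scale_multiplier].
have nu0 := normc_ge0 nu.
have [|d5 d50 h5] := dG ((1 - n nu) / 2); first by lra.
(* The radii [d1] to [d4] keep denominators nonzero, [d5] makes t contract, 1/2 forces |j| < 1 and
   |t| < 1/2, and 1 / M forces M |t| < 1. *)
pose r := Num.min (Num.min (Num.min d1 d2) (Num.min d3 d4)) (Num.min d5 (Num.min (1 / 2) (M^-1))).
have r0 : 0 < r by rewrite !lt_min d10 d20 d30 d40 d50 invr_gt0 M0 !andbT; lra.
have [P [Pr Ps P0]] := saddle_orbit (strict_diff_shapeMap b c) dG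
  (shapeMap0 b c) (scaleMap0 b c _) normc_shape_multiplier nu1 r0.
have PE m : P m = ((P m).1, (P m).2) by case: (P m).
have Pn m : [/\ [/\ (P m).1 != 0, 4 + 27 * (P m).1 != 0, scaledU b c ((P m).1, (P m).2) != 0
    & scaledV b c ((P m).1, (P m).2) != 0], n (P m).1 < 1, n (P m).2 < 1 / 2,
    M * n (P m).2 < 1 & n (P m.+1).2 <= (1 + n nu) / 2 * n (P m).2].
  have := Pr m; rewrite !lt_min => /andP[/andP[/andP[p1 p2] /andP[p3 p4]] /andP[p5 /andP[p6 p7]]].
  rewrite -!PE h1 // h2 // h3 // h4 //.
  have j1 := le_normc_add (P m).1 j0.
  have dj : n ((P m).1 - j0) <= dist2 (P m) (j0, 0) by rewrite /dist2 lerDl normc_ge0.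
  have dt : n (P m).2 <= dist2 (P m) (j0, 0) by rewrite /dist2 /= subr0 lerDr normc_ge0.
  split => //.
  - by lra.
  - by lra.
  - by rewrite -ltr_pdivlMl // mulr1; apply: le_lt_trans dt _.
  (* Comparison with (j, 0), where [scaleMap] vanishes, gives a uniform contraction rate for t. *)
  have q5 : dist2 ((P m).1, 0) (j0, 0) < d5.
    apply: le_lt_trans p5; rewrite /dist2 [X in _ + n X]/= [in X in X <= _]subrr.
    by rewrite Normc.normc0 lerD2l normc_ge0.
  have := h5 (P m) ((P m).1, 0) p5 q5.
  rewrite scaleMap0 /dist2 [(P m).1 - _]subrr [(P m).2 - _]subr0 Normc.normc0.
  rewrite add0r mul0r add0r subr0.
  have -> : (P m.+1).2 = scaleMap b c (P m) by rewrite Ps.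
  move=> hh.
  have := le_normc_add (scaleMap b c (P m)) (nu * (P m).2).
  by rewrite (Normc.normcM nu); lra.
have tn m : (P m).2 != 0.
  elim: m => [|m IH]; first exact: P0.
  have [[_ _ Un Vn] _ _ _ _] := Pn m; rewrite Ps /= PE /scaleMap.
  by rewrite mulf_neq0 ?invr_neq0 // mulf_neq0.
pose u m := ((P m).1 * (P m).2 ^+ 2)^-1; pose v m := ((P m).1 * (P m).2 ^+ 3)^-1.
have vE m : n (u m) = n (v m) * n (P m).2.
  rewrite -Normc.normcM; congr n; rewrite /u /v; field.
  by rewrite tn; have [[-> _ _ _] _ _ _ _] := Pn m.
have u1 m : 1 <= n (u m).
  have [[jm _ _ _] j1 t1 _ _] := Pn m.
  have jp : 0 < n (P m).1 by rewrite normc_gt0.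
  have tp : 0 < n (P m).2 by rewrite normc_gt0.
  rewrite /u Normc.normcV invf_ge1 ?Normc.normcM ?expr2 ?Normc.normcM ?mulr_gt0 //.
  by nra.
have vgt K m : K * n (P m).2 < 1 -> K * n (u m) < n (v m).
  move=> h; rewrite vE mulrCA -[X in _ < X]mulr1 ltr_pM2l //.
  rewrite lt_neqAle normc_ge0 andbT; apply/eqP => h0.
  by have := u1 m; rewrite vE -h0 mul0r; lra.
exists u, v; split.
- move=> m; have [[jm Dm Um Vm] _ _ _ _] := Pn m.
  rewrite /= /u /v Ps /= (PE m) /=.
  exact: cubic_coef_step.
- by move=> m; split; [exact: u1 | apply: vgt; have [] := Pn m].
move=> K.
pose k := (1 + n nu) / 2.
have k01 : 0 <= k < 1 by rewrite /k; apply/andP; split; lra.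
have [k0 k1] := andP k01.
have tk m : n (P m).2 <= k ^+ m.
  elim: m => [|m IH]; first by rewrite expr0; have [_ _ ? _ _] := Pn 0%N; lra.
  rewrite exprS; have [_ _ _ _ h] := Pn m; apply: le_trans h _.
  by rewrite ler_wpM2l.
have K1 : 0 < `|K| + 1 by have := normr_ge0 K; lra.
have /cvgrPdist_lt/(_ (`|K| + 1)^-1) : ((fun m => k ^+ m) @ \oo --> (0 : R))%classic.
  by apply: cvg_expr; rewrite ger0_norm.
rewrite invr_gt0 => /(_ K1)[N _ hN]; exists N => m Nm; apply: vgt.
have := hN m Nm; rewrite /= sub0r normrN ger0_norm ?exprn_ge0 // => hk.
have := tk m; have := ler_norm K; have := normc_ge0 (P m).2 => h h' h''.
have : (`|K| + 1) * n (P m).2 < 1.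
  rewrite -ltr_pdivlMl // mulr1; exact: le_lt_trans h'' hk.
by nra.
Qed.

(** If |y| <= M, then |v| = |y^3 + u y| <= (M^3 + M) |u|, as |u| >= 1. *)
Lemma root_large (u v y : C) (M : R) : 0 <= M -> 1 <= n u ->
  (M + M ^+ 3) * n u < n v -> y ^+ 3 + u * y + v = 0 -> M < n y.
Proof.
move=> M0 u1 vu h; rewrite ltNge; apply/negP => yM.
have vE : v = - (y * y * y + u * y) by apply/eqP; rewrite -subr_eq0 -h; apply/eqP; ring.
have := le_normcD (y * y * y) (u * y); rewrite -normcN -vE => hv.
have yy := normcM_le yM yM.
have yyy := normcM_le yy yM.
have uy := normcM_le (lexx (n u)) yM.
have : M * M * M <= M ^+ 3 * n u.
  by rewrite (_ : M * M * M = M ^+ 3) ?ler_peMr ?exprn_ge0 //; ring.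
by lra.
Qed.

Definition cubic_step (b c : C) (w : C * C * C) : C * C * C :=
  let: (x, y, z) := w in
  (x - (x ^+ 3 + b * x + c) / ((x - y) * (x - z)),
   y - (y ^+ 3 + b * y + c) / ((y - x) * (y - z)),
   z - (z ^+ 3 + b * z + c) / ((z - x) * (z - y))).

Lemma depressed_cubic_roots (u v : C) : exists x y z : C,
  [/\ x + y + z = 0, u = x * y + y * z + z * x & v = - (x * y * z)].
Proof.
(* The equation solved is x^3 = - u x - v, hence the signs. *)
have [x hx] := @solve_monicpoly C 3 (fun i => if i == 0%N then - v else if i == 1%N then - u else 0) isT.
rewrite !big_ord_recl big_ord0 /= in hx.
(* The discriminant of the quotient Z^2 + x Z + (x^2 + u). *)
have [s sE] : exists s, s ^+ 2 = x ^+ 2 - 4 * (x ^+ 2 + u).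
  by exists (sqrtc (x ^+ 2 - 4 * (x ^+ 2 + u))); exact: sqr_sqrtc.
have uE : u = - (3 * x ^+ 2 + s ^+ 2) / 4 by rewrite sE; field; rewrite ?(natC_neq0 3).
have vE : v = - x ^+ 3 - u * x by rewrite hx /bump /=; ring.
have two : (2 : C) != 0 by exact: (natC_neq0 1).
exists x, ((- x + s) / 2), ((- x - s) / 2); rewrite vE uE.
by split; field; rewrite ?(natC_neq0 3).
Qed.

(** Roots are chosen at time 0 only; afterwards the coefficients of the iterated triple follow the
    orbit of [coef_orbit], and [root_large] bounds its components from below. *)
Lemma cubic_orbit (b c : C) (M : R) : 0 < M -> exists w : C * C * C,
  (forall m, let: (x, y, z) := iter m (cubic_step b c) w in
     [/\ [/\ x != y, y != z & z != x], x + y + z = 0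
       & [/\ M < n x, M < n y & M < n z]]) /\
  (forall K, exists N, forall m, (N <= m)%N ->
     let: (x, y, z) := iter m (cubic_step b c) w in K < n x).
Proof.
move=> M0; have M1 : 0 < M + M ^+ 3 by rewrite addr_gt0 // exprn_gt0.
have [u [v [huv hM hK]]] := coef_orbit b c M1.
have [x0 [y0 [z0 [s0 e0 p0]]]] := depressed_cubic_roots (u 0%N) (v 0%N).
exists (x0, y0, z0).
have inv m : let: (x, y, z) := iter m (cubic_step b c) (x0, y0, z0) in
    [/\ [/\ x != y, y != z & z != x], x + y + z = 0,
     u m = x * y + y * z + z * x & v m = - (x * y * z)].
  elim: m => [|m IH].
    rewrite /=; have [D _ _] := huv 0%N.
    by have [? _ _ _] := weierstrass_centered_cubic b c s0 e0 p0 D.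
  rewrite iterS; case: (iter m _ _) IH => [[x y] z] [_ s e p].
  have [D ue ve] := huv m; have [D' _ _] := huv m.+1.
  have [_ s' e' p'] := weierstrass_centered_cubic b c s e p D.
  rewrite /cubic_step.
  have ue' := esym (etrans e' (esym ue)); have ve' := esym (etrans p' (esym ve)).
  by have [? _ _ _] := weierstrass_centered_cubic b c s' ue' ve' D'.
have rootE (x y z : C) u' v' : x + y + z = 0 -> u' = x * y + y * z + z * x ->
    v' = - (x * y * z) -> [/\ x ^+ 3 + u' * x + v' = 0, y ^+ 3 + u' * y + v' = 0 & z ^+ 3 + u' * z + v' = 0].
  move=> s -> ->; have -> : z = - (x + y) by apply/eqP; rewrite -subr_eq0 opprK addrC s.
  by split; ring.
split=> [m|K].
  have := inv m; case: (iter m _ _) => [[x y] z] [dis s e p]; split=> //.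
  have [rx ry rz] := rootE _ _ _ _ _ s e p; have [u1 vu] := hM m.
  by split; apply: root_large u1 vu _ => //; exact: ltW.
have [N hN] := hK (`|K| + `|K| ^+ 3); exists N => m Nm.
have := inv m; case: (iter m _ _) => [[x y] z] [dis s e p].
have [rx ry rz] := rootE _ _ _ _ _ s e p; have [u1 vu] := hM m.
apply: le_lt_trans (ler_norm K) _.
by apply: root_large u1 (hN m Nm) rx.
Qed.

(** * Fibres of the Weierstrass map *)

(** A function of one variable is read as a function of the first of two, so that the rules for
    [strict_diff] apply. *)
Definition sdiff (g : C -> C) (e : C) :=
  exists a b, strict_diff (fun p => g p.1) (e, 0) a b.

Lemma sdiff_cst c e : sdiff (fun _ => c) e.
Proof. by exists 0, 0; exact: strict_diff_cst. Qed.

Lemma sdiff_id e : sdiff (fun x => x) e.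
Proof. by exists 1, 0; exact: strict_diff_fst. Qed.

Lemma sdiffD f g e : sdiff f e -> sdiff g e -> sdiff (fun x => f x + g x) e.
Proof. by move=> [a [b hf]] [a' [b' hg]]; do 2 eexists; exact: strict_diffD hf hg. Qed.

Lemma sdiffM f g e : sdiff f e -> sdiff g e -> sdiff (fun x => f x * g x) e.
Proof. by move=> [a [b hf]] [a' [b' hg]]; do 2 eexists; exact: strict_diffM hf hg. Qed.

Lemma sdiff_eq f g e : f =1 g -> sdiff f e -> sdiff g e.
Proof.
by move=> fg [a [b hf]]; exists a, b; apply: (strict_diff_eq hf) => // p; exact: fg.
Qed.

Lemma sdiffN f e : sdiff f e -> sdiff (fun x => - f x) e.
Proof.
move=> hf; apply: (sdiff_eq (f := fun x => -1 * f x)) => [x|]; first by rewrite mulN1r.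
exact: sdiffM (sdiff_cst _ _) hf.
Qed.

Lemma sdiffX f m e : sdiff f e -> sdiff (fun x => f x ^+ m) e.
Proof.
move=> hf; elim: m => [|m IH]; first by apply: sdiff_eq (sdiff_cst 1 e) => x; rewrite expr0.
by apply: sdiff_eq (sdiffM hf IH) => x; rewrite exprS.
Qed.

Lemma sdiffV f e : f e != 0 -> sdiff f e -> sdiff (fun x => (f x)^-1) e.
Proof.
by move=> f0 [a [b hf]]; do 2 eexists; exact: strict_diff_comp (strict_diff1V f0) hf.
Qed.

Lemma sdiff_sqrtc f e : 0 < complex.Re (f e) -> sdiff f e ->
  sdiff (fun x => sqrtc (f x)) e.
Proof.
by move=> f0 [a [b hf]]; do 2 eexists; exact: strict_diff_comp (strict_diff1_sqrtc f0) hf.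
Qed.

Ltac sdiff_tac := repeat lazymatch goal with
  | |- sdiff (fun _ => ?c) ?e => exact (sdiff_cst c e)
  | |- sdiff (fun x => x) ?e => exact (sdiff_id e)
  | |- sdiff (fun x => @?f x + @?g x) ?e => apply (@sdiffD f g e)
  | |- sdiff (fun x => @?f x * @?g x) ?e => apply (@sdiffM f g e)
  | |- sdiff (fun x => - @?f x) ?e => apply (@sdiffN f e)
  | |- sdiff (fun x => @?f x ^+ ?m) ?e => apply (@sdiffX f m e)
  end.

Lemma sdiff_derivable f e : sdiff f e -> C_derivable f e.
Proof.
move=> [a [b hf]]; apply/cvg_ex; exists a; apply/cvgrPdist_le => /= eps eps0.
(* The tolerance is a positive element of [C], hence real. *)
have [r er] : exists r : R, eps = r%:C.
  by exists (complex.Re eps); rewrite RRe_real // gtr0_real.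
have r0 : 0 < r by rewrite -ltcR -er.
have [dl dl0 h] := hf r r0.
have dlC : 0 < dl%:C :> C by rewrite ltcR.
apply: filterS (dnbhs_ball (0 : C^o) dlC) => t [/= tball /eqP t0].
have tdl : n t < dl by move: tball; rewrite -ball_normE /= sub0r normrN normc_ltC.
have d0 : dist2 (e, 0) (e, 0) < dl by rewrite /dist2 subrr subrr Normc.normc0 addr0.
have dt : dist2 (t + e, 0) (e, 0) = n t.
  by rewrite /dist2 [X in n X + _]addrK [X in _ + n X]subrr Normc.normc0 addr0.
have := h (t + e, 0) (e, 0); rewrite dt => /(_ tdl d0).
rewrite [in X in _ * X]addrK [X in _ + _ * X]subrr mulr0 addr0 => ht.
rewrite er; have -> (x : C) : `|x| = (n x)%:C by case: x.
rewrite lecR scaler1 /=.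
rewrite (_ : a - _ = - (t^-1 * (f (t + e) - f e - a * t))); last first.
  by rewrite /GRing.scale /=; field.
by rewrite normcN Normc.normcM Normc.normcV mulrC ler_pdivrMr ?normc_gt0.
Qed.

(** * Open conditions near the origin *)

Definition near0 (P : C -> Prop) := exists2 dl : R, 0 < dl & forall e, n e < dl -> P e.

Lemma near0_and P Q : near0 P -> near0 Q -> near0 (fun e => P e /\ Q e).
Proof.
move=> [d1 d10 h1] [d2 d20 h2]; exists (Num.min d1 d2); first by rewrite lt_min d10.
by move=> e; rewrite lt_min => /andP[/h1 ? /h2].
Qed.

Lemma near0_sub (P Q : C -> Prop) : near0 P -> (forall e, P e -> Q e) -> near0 Q.
Proof. by move=> [d d0 h] PQ; exists d => // e /h /PQ. Qed.

Lemma near0_lt f (eps : R) : 0 < eps -> sdiff f 0 -> near0 (fun e => n (f e - f 0) < eps).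
Proof.
move=> e0 [a [b hf]]; have [dl dl0 h] := strict_diff_cont hf e0.
exists dl => // e edl; apply: (h (e, 0)).
by rewrite /dist2 [X in n X + _]subr0 [X in _ + n X]subrr Normc.normc0 addr0.
Qed.

Lemma near0_neq f g : sdiff f 0 -> sdiff g 0 -> f 0 != g 0 -> near0 (fun e => f e != g e).
Proof.
move=> hf hg fg; have fg0 : 0 < n (f 0 - g 0) by rewrite normc_gt0 subr_eq0.
apply: near0_sub (near0_lt fg0 (sdiffD hf (sdiffN hg))) _ => e h.
apply/eqP => E; move: h; rewrite E subrr sub0r normcN ltxx //.
Qed.

Lemma near0_notin f (S : seq C) : sdiff f 0 -> f 0 \notin S -> near0 (fun e => f e \notin S).
Proof.
move=> hf; elim: S => [|a S IH]; first by exists 1.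
rewrite inE negb_or => /andP[fa /IH hS].
apply: near0_sub (near0_and (near0_neq hf (sdiff_cst a 0) fa) hS) _ => e [ea eS].
by rewrite inE negb_or ea.
Qed.

(** Rewriting 1 / e = a as e a = 1 gives a condition continuous at 0, where it fails. *)
Lemma near0_inv_notin (S : seq C) : near0 (fun e => e != 0 -> e^-1 \notin S).
Proof.
elim: S => [|a S IH]; first by exists 1.
have hm : sdiff (fun e => e * a) 0 by exact: sdiffM (sdiff_id _) (sdiff_cst _ _).
have h : near0 (fun e => e * a != 1).
  by apply: near0_neq hm (sdiff_cst 1 0) _; rewrite mul0r eq_sym oner_eq0.
apply: near0_sub (near0_and h IH) _ => e [ea eS] e0.
rewrite inE negb_or eS // andbT; apply: contraNneq ea => <-.
by rewrite divff.
Qed.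

Lemma fibre_curve (a2 a1 a0 z1 z2 z3 : C) (S : seq C) :
  z1 + z2 + z3 = - a2 -> z1 != z2 -> z1 \notin S -> z2 \notin S ->
  exists x1 x2 : C -> C, near0 (fun e => e != 0 ->
    let q x := x ^+ 3 + a2 * x ^+ 2 + a1 * x + a0 in
    [/\ C_derivable x1 e /\ C_derivable x2 e,
      [/\ q (x1 e) = (x1 e - z1) * ((x1 e - x2 e) * (x1 e - e^-1)),
          q (x2 e) = (x2 e - z2) * ((x2 e - x1 e) * (x2 e - e^-1))
        & q e^-1 = (e^-1 - z3) * ((e^-1 - x1 e) * (e^-1 - x2 e))],
      [/\ x1 e != x2 e, x1 e != e^-1 & x2 e != e^-1]
    & [/\ x1 e \notin S, x2 e \notin S & e^-1 \notin S]]).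
Proof.
move=> sumz z12 z1S z2S.
have z210 : z2 - z1 != 0 by rewrite subr_eq0 eq_sym.
pose L1 := fibL1 z2 z3; pose L2 := fibL2 z1 z3; pose L0 := fibL0 a1 a0 z1 z2 z3.
pose B := fibB a1 a0 z1 z2 z3; pose Disc := fibDisc a1 a0 z1 z2 z3.
(* At e = 0 the discriminant is (z2 - z1)^2. Dividing by it makes the ratio 1, where the principal
   root is differentiable, and the factor z2 - z1 in [sg] selects the branch with x1 = z1. *)
pose ratio e := Disc e / (z2 - z1) ^+ 2.
pose sg e := (z2 - z1) * sqrtc (ratio e).
pose x1 e := (sg e - B e) / (2 * L1 e).
pose x2 e := - (L0 e + L1 e * x1 e) / L2 e.
have two : (2 : C) != 0 by rewrite pnatr_eq0.
have nz0 : (-2 : C) != 0 by rewrite oppr_eq0.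
have sdL1 e : sdiff L1 e by rewrite /L1 /fibL1 /fibA1; sdiff_tac.
have sdL2 e : sdiff L2 e by rewrite /L2 /fibL2 /fibA2; sdiff_tac.
have sdL0 e : sdiff L0 e by rewrite /L0 /fibL0 /fibA0; sdiff_tac.
have sdB e : sdiff B e.
  by rewrite /B /fibB /fibL0 /fibA0 /fibA1 /fibA2; sdiff_tac.
have sdR e : sdiff ratio e.
  apply: sdiffM; last exact: sdiff_cst.
  by rewrite /Disc /fibDisc /fibC /fibL1 /fibB /fibL0 /fibA0 /fibA1 /fibA2; sdiff_tac.
have L10 : L1 0 = -2 by rewrite /L1 /fibL1 /fibA1; ring.
have L20 : L2 0 = -2 by rewrite /L2 /fibL2 /fibA2; ring.
have L00 : L0 0 = 2 * (z1 + z2) by rewrite /L0 /fibL0 /fibA0; ring.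
have B0 : B 0 = 3 * z1 + z2 by rewrite /B /fibB /fibL0 /fibA0 /fibA1 /fibA2; ring.
have R0 : ratio 0 = 1.
  rewrite /ratio (_ : Disc 0 = (z2 - z1) ^+ 2) ?divff ?expf_neq0 //.
  by rewrite /Disc /fibDisc /fibC /fibL1 /fibB /fibL0 /fibA0 /fibA1 /fibA2; ring.
have x10 : x1 0 = z1.
  by rewrite /x1 /sg R0 sqrtc1 B0 L10; field; rewrite ?nz0 ?two.
have x20 : x2 0 = z2.
  by rewrite /x2 x10 L00 L10 L20; field; rewrite ?nz0 ?two.
have sdx1 e : L1 e != 0 -> 0 < complex.Re (ratio e) -> sdiff x1 e.
  move=> l r; apply: sdiffM; last first.
    by apply: sdiffV; [rewrite mulf_neq0 | apply: sdiffM (sdiff_cst _ _) _].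
  apply: sdiffD; last exact: sdiffN.
  by apply: sdiffM (sdiff_cst _ _) _; exact: sdiff_sqrtc.
have sdx2 e : L1 e != 0 -> L2 e != 0 -> 0 < complex.Re (ratio e) -> sdiff x2 e.
  move=> l1 l2 r; apply: sdiffM; last exact: sdiffV.
  by apply: sdiffN; apply: sdiffD => //; apply: sdiffM => //; exact: sdx1.
have sx1 : sdiff x1 0 by apply: sdx1; rewrite ?L10 ?R0 //= ltr01.
have sx2 : sdiff x2 0 by apply: sdx2; rewrite ?L10 ?L20 ?R0 //= ltr01.
have nL1 : near0 (fun e => L1 e != 0).
  by apply: near0_neq (sdL1 0) (sdiff_cst 0 0) _; rewrite L10.
have nL2 : near0 (fun e => L2 e != 0).
  by apply: near0_neq (sdL2 0) (sdiff_cst 0 0) _; rewrite L20.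
have nR : near0 (fun e => 0 < complex.Re (ratio e)).
  apply: near0_sub (near0_lt ltr01 (sdR 0)) _ => e; rewrite R0 => h.
  by have := Re_le_normc (1 - ratio e); rewrite normcB raddfB /=; lra.
have n12 : near0 (fun e => x1 e != x2 e).
  by apply: near0_neq => //; rewrite x10 x20.
have nS1 : near0 (fun e => x1 e \notin S) by apply: near0_notin; rewrite ?x10.
have nS2 : near0 (fun e => x2 e \notin S) by apply: near0_notin; rewrite ?x20.
have ninv f : sdiff f 0 -> near0 (fun e => e != 0 -> f e != e^-1).
  move=> hf; have h : sdiff (fun e => e * f e) 0 by exact: sdiffM (sdiff_id _) hf.
  have h' : near0 (fun e => e * f e != 1).
    by apply: near0_neq h (sdiff_cst 1 0) _; rewrite mul0r eq_sym oner_eq0.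
  apply: near0_sub h' _ => e h1 e0; apply: contraNneq h1 => ->.
  by rewrite divff.
exists x1, x2.
apply: near0_sub (near0_and (near0_and (near0_and nL1 nL2) (near0_and nR n12))
  (near0_and (near0_and nS1 nS2)
    (near0_and (near0_inv_notin S) (near0_and (ninv _ sx1) (ninv _ sx2))))) _.
move=> e [[[l1 l2] [re e12]] [[s1 s2] [si [i1 i2]]]] e0.
split.
- by split; apply: sdiff_derivable; [apply: sdx1 | apply: sdx2].
- apply: (fibre_weierstrass (s := sg e)) => //.
  rewrite /sg exprMn sqr_sqrtc /ratio mulrC divfK // expf_neq0 //.
- by split=> //; [apply: i1 | apply: i2].
- by split=> //; apply: si.
Qed.

(** * Freezing all but three components at roots *)

(** Prepending a point only shifts the orbit by one, so a fibre inherits escape from its image. *)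
Lemma escaping_weierstrass (p : {poly C}) d (z : 'rV[C]_d) :
  off_diag z -> escaping p (weierstrass p z) -> escaping p z.
Proof.
move=> z0 [od oi]; split.
  by case=> [//|m]; rewrite iterSr; exact: od.
move=> M; have [N hN] := oi M; exists N.+1 => -[//|m] Nm.
by rewrite iterSr; exact: hN.
Qed.

Definition cubic_weierstrass (q : C -> C) (w : C * C * C) : C * C * C :=
  let: (x, y, z) := w in
  (x - q x / ((x - y) * (x - z)), y - q y / ((y - x) * (y - z)),
   z - q z / ((z - x) * (z - y))).

(** The moving components come first. The default of [nth] is never reached when [size S = m]. *)
Definition extend m (S : seq C) (w : C * C * C) : 'rV[C]_m.+3 :=
  let: (x, y, z) := w in \row_k [:: x, y, z & S]`_k.

Definition admissible (S : seq C) (w : C * C * C) :=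
  let: (x, y, z) := w in uniq [:: x, y, z & S].

Lemma off_diag_extend m S w : size S = m -> admissible S w -> off_diag (extend m S w).
Proof.
case: w => [[x y] z] sS u j k jk.
by rewrite !mxE nth_uniq //= sS.
Qed.

(** Simple roots make [p] coprime to its derivative, and a product of monic linear factors is
    separable exactly when its roots are distinct. *)
Lemma roots_of_simple (p : {poly C}) :
  (forall x, root p x -> ~~ root p^`() x) -> p != 0 ->
  exists2 rs : seq C, uniq rs & p = lead_coef p *: \prod_(r <- rs) ('X - r%:P).
Proof.
move=> hs p0; have [rs prs] := closed_field_poly_normal p.
exists rs => //; rewrite -separable_prod_XsubC.
have : separable_poly p by rewrite unlock; apply/Pdiv.ClosedField.coprimepP => x; exact: hs.
by rewrite {1}prs (eqp_separable (eqp_scale _ _)) ?lead_coef_eq0.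
Qed.

(** A component at a root of [p] is fixed. For a moving component the factors t - s with s in [S]
    cancel between [p] and the denominator. *)
Lemma weierstrass_extend (p : {poly C}) m (r0 r1 r2 : C) (S : seq C) w :
  p != 0 -> size S = m ->
  p = lead_coef p *: \prod_(r <- [:: r0, r1, r2 & S]) ('X - r%:P) ->
  admissible S w ->
  weierstrass p (extend m S w) =
  extend m S (cubic_weierstrass (fun t => (t - r0) * (t - r1) * (t - r2)) w).
Proof.
case: w => [[x y] z] p0 sS pE u.
have lc0 : lead_coef p != 0 by rewrite lead_coef_eq0.
pose T (t : C) := \prod_(i < m) (t - S`_i).
have pT t : (lead_coef p)^-1 * p.[t] = (t - r0) * (t - r1) * (t - r2) * T t.
  rewrite {2}pE hornerZ mulKf // horner_prod !big_cons !hornerXsubC !mulrA; congr (_ * _).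
  rewrite (big_nth 0) big_mkord sS; apply: eq_bigr => i _; exact: hornerXsubC.
have T0 t : t \notin S -> T t != 0.
  move=> tS; apply/prodf_neq0 => i _; rewrite subr_eq0; apply: contraNneq tS => ->.
  by rewrite mem_nth // sS.
have [[xS yS zS] [xy xz yz]] : [/\ x \notin S, y \notin S & z \notin S] /\ [/\ x != y, x != z & y != z].
  move: u => /= /and4P[]; rewrite !inE !negb_or => /and3P[-> -> ->] /andP[-> ->] -> _.
  by split; split.
have nz a b : a != b -> a - b != 0 :> C by rewrite subr_eq0.
have yx : y != x by rewrite eq_sym.
have zx : z != x by rewrite eq_sym.
have zy : z != y by rewrite eq_sym.
apply/rowP => k; rewrite !mxE.
case: k => [[|[|[|k]]] kd] /=; rewrite pT.
- rewrite big_mkcond !big_ord_recl /= !mxE /= mul1r.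
  rewrite [X in _ * (_ * X)](_ : _ = T x); last by apply: eq_bigr => i _; rewrite !mxE.
  by field; rewrite ?T0 ?nz.
- rewrite big_mkcond !big_ord_recl /= !mxE /= mul1r.
  rewrite [X in _ * (_ * X)](_ : _ = T y); last by apply: eq_bigr => i _; rewrite !mxE.
  by field; rewrite ?T0 ?nz.
- rewrite big_mkcond !big_ord_recl /= !mxE /= mul1r.
  rewrite [X in _ * (_ * X)](_ : _ = T z); last by apply: eq_bigr => i _; rewrite !mxE.
  by field; rewrite ?T0 ?nz.
have km : (k < m)%N by rewrite -2!ltnS -ltnS.
rewrite (_ : T _ = 0) ?mulr0 ?mul0r ?subr0 //.
by apply/eqP/prodf_eq0; exists (Ordinal km) => //=; rewrite subrr.
Qed.

(** The map commutes with translations, and centring at the barycentre of the roots kills the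
    quadratic coefficient. *)
Lemma cubic_weierstrass_shift (r0 r1 r2 h : C) (w : C * C * C) :
  let q t := (t - r0) * (t - r1) * (t - r2) in
  h = (r0 + r1 + r2) / 3 ->
  let s0 := r0 - h in let s1 := r1 - h in let s2 := r2 - h in
  let shift (w : C * C * C) := (w.1.1 + h, w.1.2 + h, w.2 + h) in
  cubic_weierstrass q (shift w) =
  shift (cubic_step (s0 * s1 + s1 * s2 + s2 * s0) (- (s0 * s1 * s2)) w).
Proof.
case: w => [[x y] z] q hE s0 s1 s2 shift.
have n3 : (3 : C) != 0 by rewrite pnatr_eq0.
have s012 : r0 = 3 * h - r1 - r2 by rewrite hE; field.
have qE t : q (t + h) = t ^+ 3 + (s0 * s1 + s1 * s2 + s2 * s0) * t + - (s0 * s1 * s2).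
  by rewrite /q /s0 /s1 /s2 s012; ring.
have dE a b : a + h - (b + h) = a - b by ring.
by rewrite /shift /= !qE !dE; congr (_, _, _); ring.
Qed.

(** The condition on the sum is the one under which [fibre_curve] applies. *)
Lemma cubic_escaping (p : {poly C}) m (r0 r1 r2 : C) (S : seq C) :
  p != 0 -> size S = m -> uniq S ->
  p = lead_coef p *: \prod_(r <- [:: r0, r1, r2 & S]) ('X - r%:P) ->
  exists x y z, [/\ admissible S (x, y, z), x + y + z = r0 + r1 + r2
    & escaping p (extend m S (x, y, z))].
Proof.
move=> p0 sS uS pE.
pose h := (r0 + r1 + r2) / 3.
pose shift (w : C * C * C) := (w.1.1 + h, w.1.2 + h, w.2 + h).
pose b := (r0 - h) * (r1 - h) + (r1 - h) * (r2 - h) + (r2 - h) * (r0 - h).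
pose c := - ((r0 - h) * (r1 - h) * (r2 - h)).
(* [M] exceeds the distance from [h] to every frozen root, so a centred component of modulus above
   [M] meets none of them. *)
pose M := 1 + \sum_(s <- S) n (s - h).
have M0 : 0 < M.
  by have : 0 <= \sum_(s <- S) n (s - h) by [apply: sumr_ge0 => s _; exact: normc_ge0]; rewrite /M; lra.
have MS t : M < n t -> t + h \notin S.
  move=> Mt; apply/negP => tS; move: Mt; rewrite ltNge => /negP; apply.
  rewrite /M (big_rem _ tS) /= addrK.
  have : 0 <= \sum_(s <- rem (t + h) S) n (s - h) by apply: sumr_ge0 => s _; exact: normc_ge0.
  by lra.
have [w [hw hinf]] := cubic_orbit b c M0.
pose P k := iter k (cubic_step b c) w.
have adm k : admissible S (shift (P k)).
  have := hw k; rewrite /P; case: (iter k _ _) => [[x y] z] [[xy yz zx] _ [xM yM zM]].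
  rewrite /shift /= uS !inE !negb_or !MS // !(inj_eq (addIr h)).
  by rewrite xy yz (eq_sym x z) zx.
have it k : iter k (@weierstrass R p m.+3) (extend m S (shift w)) = extend m S (shift (P k)).
  elim: k => [//|k IH]; rewrite iterS IH (weierstrass_extend p0 sS pE) //.
  by rewrite cubic_weierstrass_shift.
have := hw 0%N; rewrite /= => h0.
exists (w.1.1 + h), (w.1.2 + h), (w.2 + h); split.
- exact: (adm 0%N).
- have n3 : (3 : C) != 0 by rewrite pnatr_eq0.
  case: w {hw hinf P adm it} h0 => [[x y] z] [_ s _] /=.
  rewrite (_ : x + h + (y + h) + (z + h) = (x + y + z) + 3 * h); last by ring.
  by rewrite s add0r /h; field.
split=> [k|K]; first by rewrite it; apply: off_diag_extend (adm k).
have [N hN] := hinf (K + n h); exists N => k Nk; exists ord0.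
have := hN k Nk; rewrite it /P; case: (iter k _ _) => [[x y] z] Kx.
rewrite /shift mxE /=; have -> (t : C) : `|t| = (n t)%:C by case: t.
rewrite ltcR; have := le_normc_add x (x + h); rewrite (_ : x - (x + h) = - h); last by ring.
by rewrite normcN; lra.
Qed.

End EscapingOrbits.

(** * The escaping curve in degree d *)

Unset Implicit Arguments.
Set Strict Implicit.

Theorem theorem2 (R : realType) (d : nat) (p : {poly R[i]})
  (hdeg : size p = d.+1) (hd : (3 <= d)%N)
  (hsimple : forall x : R[i], root p x -> ~~ root p^`() x) :
  (exists z : 'rV[R[i]]_d, escaping p z) /\
  (exists (c : R[i]) (r : R) (gamma : R[i] -> 'rV[R[i]]_d),
      0 < r /\
      holomorphic_on_disk gamma c r /\
      (exists t1 t2 : R[i], `|t1 - c| < r%:C /\ `|t2 - c| < r%:C /\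
                            gamma t1 != gamma t2) /\
      (forall t : R[i], `|t - c| < r%:C -> escaping p (gamma t))).
Proof.
(* The centre of the disk yields the escaping point of the first claim. *)
suff curve : exists (c : R[i]) (r : R) (gamma : R[i] -> 'rV[R[i]]_d),
      0 < r /\
      holomorphic_on_disk gamma c r /\
      (exists t1 t2 : R[i], `|t1 - c| < r%:C /\ `|t2 - c| < r%:C /\
                            gamma t1 != gamma t2) /\
      (forall t : R[i], `|t - c| < r%:C -> escaping p (gamma t)).
  split=> //; have [c [r [gamma [r0 [_ [_ h]]]]]] := curve.
  by exists (gamma c); apply: h; rewrite subrr normr0 ltcR.
have p0 : p != 0 by rewrite -size_poly_gt0 hdeg.
have [rs urs prs] := roots_of_simple hsimple p0.
have srs : size rs = d.
  have := congr1 (fun q : {poly R[i]} => size q) prs.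
  by rewrite hdeg size_scale ?lead_coef_eq0 // size_prod_XsubC => -[].
case: rs urs prs srs hd => [|r0 [|r1 [|r2 S]]] urs prs srs; rewrite -srs // => _.
have uS : uniq S by case/and4P: urs.
have [z1 [z2 [z3 [adm sumz esc]]]] := cubic_escaping p0 erefl uS prs.
have [[z12 z1S z2S]] : [/\ z1 != z2, z1 \notin S & z2 \notin S].
  move: adm => /= /and4P[]; rewrite !inE !negb_or => /and3P[-> _ ->] /andP[_ ->] _ _.
  by [].
pose a2 := - (r0 + r1 + r2); pose a1 := r0 * r1 + r1 * r2 + r2 * r0; pose a0 := - (r0 * r1 * r2).
have sumz' : z1 + z2 + z3 = - a2 by rewrite opprK.
have [x1 [x2 [rho rho0 hx]]] := fibre_curve a1 a0 sumz' z12 z1S z2S.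
have qE t : (t - r0) * (t - r1) * (t - r2) = t ^+ 3 + a2 * t ^+ 2 + a1 * t + a0.
  by rewrite /a2 /a1 /a0; ring.
pose gamma e := extend (size S) S (x1 e, x2 e, e^-1).
(* The disk of centre and radius [rho / 2] lies in the punctured disk of radius [rho] about 0. *)
have disk t : `|t - (rho / 2)%:C| < (rho / 2)%:C -> Normc.normc t < rho /\ t != 0.
  rewrite normc_ltC => ht; split.
    have := le_normc_add t (rho / 2)%:C; rewrite normcR ger0_norm; lra.
  by apply/eqP => t0; move: ht; rewrite t0 sub0r normcN normcR ger0_norm; lra.
exists (rho / 2)%:C, (rho / 2), gamma; split; first by lra.
split.
  move=> t /disk[tr t0]; have [[d1 d2] _ _ _] := hx t tr t0.
  case=> [[|[|[|k]]] kd].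
  - by rewrite (_ : (fun s => _) = x1) //; apply/funext => s; rewrite mxE.
  - by rewrite (_ : (fun s => _) = x2) //; apply/funext => s; rewrite mxE.
  - rewrite (_ : (fun s => _) = (fun s => s^-1)); last by apply/funext => s; rewrite mxE.
    apply: sdiff_derivable; apply: sdiffV => //; exact: sdiff_id.
  - rewrite (_ : (fun s => _) = (fun s => S`_k)); last by apply/funext => s; rewrite mxE.
    exact: sdiff_derivable (sdiff_cst _ _).
split.
  (* The third component 1 / e already separates these two parameters. *)
  exists (rho / 2)%:C, (rho / 4)%:C; split; first by rewrite subrr normr0 ltcR; lra.
  split; first by rewrite normc_ltC -rmorphB normcR ltr_norml /=; lra.
  apply/eqP => /rowP /(_ (inord 2)); rewrite !mxE inordK //= => /invr_inj /complexI; lra.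
move=> t /disk[tr t0]; have [_ [q1 q2 q3] [d12 d1 d2] [s1 s2 s3]] := hx t tr t0.
have ad : admissible S (x1 t, x2 t, t^-1).
  by rewrite /= uS !inE !negb_or d12 d1 d2 s1 s2 s3.
apply: escaping_weierstrass; first exact: off_diag_extend.
rewrite (weierstrass_extend p0 erefl prs ad).
(* One step sends every point of the curve to the same escaping point. *)
suff -> : cubic_weierstrass (fun t => (t - r0) * (t - r1) * (t - r2)) (x1 t, x2 t, t^-1)
   = (z1, z2, z3) by [].
rewrite /= !qE q1 q2 q3.
have nz (a b c : R[i]) : a != b -> a != c -> (a - b) * (a - c) != 0.
  by move=> ab ac; rewrite mulf_neq0 // subr_eq0.
have D (a b c : R[i]) : c != 0 -> a - (a - b) * c / c = b.
  by move=> c0; rewrite mulfK // opprB addrC subrK.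
by rewrite !D // nz // eq_sym.
Qed.
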